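(* For unsplittable Cu-VRPSD there is a randomized polynomial-time $(\alpha+2)$-approximation algorithm, where $\alpha$ is the approximation ratio of a polynomial-time algorithm for metric TSP.
   Context: Cu-VRPSD: an instance consists of a complete undirected graph on $\{v_0,v_1,\dots,v_n\}$ ($v_0$ the depot, $v_1,\dots,v_n$ customers), a metric edge weight $w$ (nonnegative, symmetric, triangle inequality), a vehicle capacity $Q>0$, parameters $a,b\ge0$, and independent random demands $\chi_1,\dots,\chi_n$ with values in $[0,Q]$ and distributions known in advance; the realized demand of $v_i$ is revealed only when the vehicle first visits $v_i$. A single vehicle starting at the depot performs tours (closed walks from $v_0$ back to $v_0$), loading goods at the depot, never carrying more than $Q$ units, delivering only to customers on the current tour, so that each customer receives exactly its demand; in the unsplittable variant each customer's demand must be delivered entirely in one visit. Traversing edge $uv$ while carrying $x$ units costs $a\,w(u,v)+b\,x\,w(u,v)$; the cumulative cost is the sum over all traversals (goods loaded but not delivered still count). A policy chooses the itinerary adaptively. A randomized $\rho$-approximation algorithm is a polynomial-time policy whose expected cumulative cost (over demands and internal randomness) is at most $\rho$ times the minimum expected cumulative cost over all policies. *)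

(* Defs.v *)
From HB Require Import structures.
From mathcomp Require Import all_boot all_order all_algebra all_fingroup.
From mathcomp Require Import all_classical all_reals all_analysis.

Set Implicit Arguments.
Unset Strict Implicit.
Unset Printing Implicit Defensive.

Import Order.TTheory GRing.Theory Num.Theory.

Local Open Scope classical_set_scope.
Local Open Scope ring_scope.

(** ** Metrics on the complete graph with vertex set ['I_N] *)

(* The complete graph has no loops; [w v v = 0] makes staying at [v] free. *)
Record metric (R : realType) (N : nat) := Metric {
  weight :> 'I_N -> 'I_N -> R;
  weight_ge0 : forall u v, 0 <= weight u v;
  weight_refl : forall v, weight v v = 0;
  weight_sym : forall u v, weight u v = weight v u;
  weight_triangle : forall u v x, weight u x <= weight u v + weight v x }.

(* The tour [s 0, s 1, ..., s n, s 0]; [ordS] is the cyclic successor. *)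
Definition tour_weight (R : realType) (N : nat) (w : metric R N)
    (s : {perm 'I_N}) : R :=
  \sum_(i < N) w (s i) (s (ordS i)).

(** ** A real random access machine, as a structured language

   A real RAM has natural number registers, used for control flow and as
   addresses, and real registers. Natural numbers are only added and subtracted
   (so that charging one step per operation is polynomially equivalent to
   charging for the lengths of the numbers), real numbers are subject to exact
   field operations and comparisons, with arbitrary real program constants and
   no rounding. The weights are a read-only input. The size of the input is the
   number of vertices. *)

Inductive nexp :=
| NLit of nat
| NSize
| NGet of nexp
| NAdd of nexp & nexp
| NSub of nexp & nexp.

Inductive rexp (R : Type) :=
| RLit of R
| RGet of nexp
| RWeight of nexp & nexp
| RAdd of rexp R & rexp R
| RSub of rexp R & rexp R
| RMul of rexp R & rexp R
| RDiv of rexp R & rexp R.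

Inductive bexp (R : Type) :=
| NLe of nexp & nexp
| RLe of rexp R & rexp R
| BNot of bexp R
| BAnd of bexp R & bexp R.

Inductive prog (R A : Type) :=
| Skip
| Do of A
| Seq of prog R A & prog R A
| If of bexp R & prog R A & prog R A
| While of bexp R & prog R A.
Arguments Skip {R A}.

Inductive assign (R : Type) :=
| NSet of nexp & nexp
| RSet of nexp & rexp R.

Record mem (R : Type) := Mem { nreg : nat -> nat; rreg : nat -> R }.

Definition mem0 (R : realType) : mem R := Mem (fun=> 0%N) (fun=> 0).

Definition update (T : Type) (f : nat -> T) (k : nat) (x : T) : nat -> T :=
  fun j => if j == k then x else f j.

Definition set_nreg (R : Type) (m : mem R) (k x : nat) : mem R :=
  Mem (update (nreg m) k x) (rreg m).

Definition set_rreg (R : Type) (m : mem R) (k : nat) (x : R) : mem R :=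
  Mem (nreg m) (update (rreg m) k x).

Section Eval.
Variables (R : realType) (N : nat) (w : metric R N).

Fixpoint neval (m : mem R) (e : nexp) : nat :=
  match e with
  | NLit k => k
  | NSize => N
  | NGet e1 => nreg m (neval m e1)
  | NAdd e1 e2 => (neval m e1 + neval m e2)%N
  | NSub e1 e2 => (neval m e1 - neval m e2)%N
  end.

Fixpoint reval (m : mem R) (e : rexp R) : R :=
  match e with
  | RLit r => r
  | RGet e1 => rreg m (neval m e1)
  | RWeight e1 e2 =>
      match insub (neval m e1), insub (neval m e2) with
      | Some u, Some v => w u v
      | _, _ => 0
      end
  | RAdd e1 e2 => reval m e1 + reval m e2
  | RSub e1 e2 => reval m e1 - reval m e2
  | RMul e1 e2 => reval m e1 * reval m e2
  | RDiv e1 e2 => reval m e1 / reval m e2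
  end.

Fixpoint beval (m : mem R) (e : bexp R) : bool :=
  match e with
  | NLe e1 e2 => (neval m e1 <= neval m e2)%N
  | RLe e1 e2 => reval m e1 <= reval m e2
  | BNot e1 => ~~ beval m e1
  | BAnd e1 e2 => beval m e1 && beval m e2
  end.

End Eval.

(* [exec test astep c s t s']: started in state [s], the program [c] halts in
   state [s'] after [t] steps. A fixed program evaluates only a bounded number of
   operations in each of its tests and instructions, so a test counts as one
   step. *)
Section Exec.
Variables (R A S : Type) (test : S -> bexp R -> bool).
Variable astep : A -> S -> nat -> S -> Prop.

Inductive exec : prog R A -> S -> nat -> S -> Prop :=
| exec_skip s : exec Skip s 1 s
| exec_do i s t s' : astep i s t s' -> exec (Do R i) s t s'
| exec_seq c1 c2 s s1 s2 t1 t2 :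
    exec c1 s t1 s1 -> exec c2 s1 t2 s2 -> exec (Seq c1 c2) s (t1 + t2)%N s2
| exec_if_true b c1 c2 s t s' :
    test s b = true -> exec c1 s t s' -> exec (If b c1 c2) s t.+1 s'
| exec_if_false b c1 c2 s t s' :
    test s b = false -> exec c2 s t s' -> exec (If b c1 c2) s t.+1 s'
| exec_while_true b c s s1 s2 t1 t2 :
    test s b = true -> exec c s t1 s1 -> exec (While b c) s1 t2 s2 ->
    exec (While b c) s (t1 + t2).+1 s2
| exec_while_false b c s :
    test s b = false -> exec (While b c) s 1 s.

End Exec.

(** ** Approximation algorithms for metric TSP *)

Section OfflinePrograms.
Variables (R : realType) (N : nat) (w : metric R N).

Inductive assign_step : assign R -> mem R -> nat -> mem R -> Prop :=
| step_nset d e m :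
    assign_step (NSet R d e) m 1 (set_nreg m (neval N m d) (neval N m e))
| step_rset d e m :
    assign_step (RSet d e) m 1 (set_rreg m (neval N m d) (reval w m e)).

Definition offline_exec : prog R (assign R) -> mem R -> nat -> mem R -> Prop :=
  exec (beval w) assign_step.

End OfflinePrograms.

(* The tour is returned in the natural number registers [0, ..., N - 1]. *)
Definition tsp_approx_algorithm (R : realType) (alpha : R)
    (c : prog R (assign R)) : Prop :=
  exists C k : nat, forall (n : nat) (w : metric R n.+1),
    exists t m (s : {perm 'I_n.+1}),
      [/\ offline_exec w c (mem0 R) t m,
          (t <= C * n.+1 ^ k)%N,
          forall i : 'I_n.+1, nreg m i = s i &
          forall s' : {perm 'I_n.+1},
            tour_weight w s <= alpha * tour_weight w s'].

(** ** Instances of Cu-VRPSD *)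

(* The depot is [ord0]; the customers, indexed by ['I_n], are the vertices
   [lift ord0 i]. *)
Record instance (R : realType) (n : nat) := Instance {
  dist :> metric R n.+1;
  capacity : R;
  coef_a : R;
  coef_b : R;
  law : 'I_n -> probability (measurableTypeR R) R;
  capacity_gt0 : 0 < capacity;
  coef_a_ge0 : 0 <= coef_a;
  coef_b_ge0 : 0 <= coef_b;
  law_support : forall i, law i [set` `[0, capacity]] = 1%E }.

Definition customer (n : nat) (v : 'I_n.+1) : option 'I_n := unlift ord0 v.

(** ** The vehicle *)

(* [LoadTo x], possible at the depot only, makes [x] the amount of goods on board;
   [Deliver] hands over the whole demand of the customer at which the vehicle is
   (unsplittable deliveries). *)
Inductive action (R : Type) (n : nat) :=
| LoadTo of R
| Move of 'I_n.+1
| Deliver.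
Arguments Deliver {R n}.

Record vehicle (R : Type) (n : nat) := Vehicle {
  position : 'I_n.+1;
  load : R;
  served : {set 'I_n};
  spent : R }.

Section Vehicle.
Variables (R : realType) (n : nat) (I : instance R n) (demand : 'I_n -> R).

Definition vehicle0 : vehicle R n := Vehicle ord0 0 finset.set0 0.

(* [None] if the action is not allowed. *)
Definition vehicle_step (s : vehicle R n) (x : action R n) :
    option (vehicle R n) :=
  match x with
  | LoadTo q =>
      if (position s == ord0) && (0 <= q <= capacity I)
      then Some (Vehicle (position s) q (served s) (spent s)) else None
  | Move v =>
      let d := I (position s) v in
      Some (Vehicle v (load s) (served s)
              (spent s + (coef_a I * d + coef_b I * load s * d)))
  | Deliver =>
      if customer (position s) is Some i then
        if (i \notin served s) && (demand i <= load s)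
        then Some (Vehicle (position s) (load s - demand i)
                     (i |: served s)%SET (spent s))
        else None
      else None
  end.

Definition complete (s : vehicle R n) : Prop :=
  position s = ord0 /\ served s = finset.setT.

(* The demand of the customer at which the vehicle is. *)
Definition revealed (s : vehicle R n) : option R :=
  omap demand (customer (position s)).

End Vehicle.

(** ** Policies *)

(* The past actions, each with the demand revealed after it, oldest first. *)
Definition history (R : Type) (n : nat) : Type := seq (action R n * option R).

(* [None] means that the vehicle stops. *)
Definition policy (R : Type) (n : nat) : Type :=
  history R n -> option (action R n).

Section Policies.
Variables (R : realType) (n : nat) (I : instance R n) (demand : 'I_n -> R).
Variable pi : policy R n.

Inductive policy_run : history R n -> vehicle R n -> Prop :=
| run_start : policy_run [::] (vehicle0 R n)
| run_step h s x s' :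
    policy_run h s -> pi h = Some x -> vehicle_step I demand s x = Some s' ->
    policy_run (rcons h (x, revealed demand s')) s'.

Definition policy_cost (z : R) : Prop :=
  exists h s, [/\ policy_run h s, pi h = None, complete s & spent s = z].

End Policies.

(** ** Programs controlling the vehicle *)

Inductive param := ParamA | ParamB | ParamQ.

(* [Draw d] draws a uniform random number of [0, 1]; [Cdf d v x] evaluates at [x]
   the distribution function of the demand of the customer [v]; [Sense d] reads
   the demand of the customer at which the vehicle is. *)
Inductive instr (R : Type) :=
| Compute of assign R
| Draw of nexp
| Param of nexp & param
| Cdf of nexp & nexp & rexp R
| Sense of nexp
| ActLoad of rexp R
| ActMove of nexp
| ActDeliver.
Arguments ActDeliver {R}.

Record state (R : Type) (n : nat) := State {
  memory : mem R;
  drawn : nat;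
  truck : vehicle R n }.

Section OnlinePrograms.
Variables (R : realType) (n : nat) (I : instance R n).
Variables (demand : 'I_n -> R) (tape : nat -> R).

Definition state0 : state R n := State (mem0 R) 0 (vehicle0 R n).

Definition param_value (p : param) : R :=
  match p with
  | ParamA => coef_a I
  | ParamB => coef_b I
  | ParamQ => capacity I
  end.

Inductive instr_step : instr R -> state R n -> nat -> state R n -> Prop :=
| step_compute i m k s t m' :
    assign_step I i m t m' ->
    instr_step (Compute i) (State m k s) t (State m' k s)
| step_draw d m k s :
    instr_step (Draw R d) (State m k s) 1
      (State (set_rreg m (neval n.+1 m d) (tape k)) k.+1 s)
| step_param d p m k s :
    instr_step (Param R d p) (State m k s) 1
      (State (set_rreg m (neval n.+1 m d) (param_value p)) k s)
| step_cdf d v x m k s i :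
    neval n.+1 m v = lift ord0 i ->
    instr_step (Cdf d v x) (State m k s) 1
      (State (set_rreg m (neval n.+1 m d)
                (fine (law I i [set` `]-oo, reval I m x]]))) k s)
| step_sense d m k s r :
    revealed demand s = Some r ->
    instr_step (Sense R d) (State m k s) 1
      (State (set_rreg m (neval n.+1 m d) r) k s)
| step_load x m k s s' :
    vehicle_step I demand s (LoadTo n (reval I m x)) = Some s' ->
    instr_step (ActLoad x) (State m k s) 1 (State m k s')
| step_move e m k s s' (v : 'I_n.+1) :
    neval n.+1 m e = v -> vehicle_step I demand s (Move R v) = Some s' ->
    instr_step (ActMove R e) (State m k s) 1 (State m k s')
| step_deliver m k s s' :
    vehicle_step I demand s Deliver = Some s' ->
    instr_step ActDeliver (State m k s) 1 (State m k s').

Definition online_exec :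
    prog R (instr R) -> state R n -> nat -> state R n -> Prop :=
  exec (fun s => beval I (memory s)) instr_step.

Definition program_cost (c : prog R (instr R)) (z : R) : Prop :=
  exists t s, [/\ online_exec c state0 t s, complete (truck s) &
                  spent (truck s) = z].

End OnlinePrograms.

(* On every instance, for all demands and all outcomes of the random draws, the
   program serves all customers, returns to the depot and halts, within a number
   of steps polynomial in the number of vertices. *)
Definition polynomial_time_policy (R : realType) (c : prog R (instr R)) : Prop :=
  exists C k : nat, forall (n : nat) (I : instance R n)
      (demand : 'I_n -> R) (tape : nat -> R),
    (forall i, 0 <= demand i <= capacity I) ->
    (forall j, 0 <= tape j <= 1) ->
    exists t s, [/\ online_exec I demand tape c (state0 R n) t s,
                    complete (truck s) & (t <= C * n.+1 ^ k)%N].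

(** ** Expected costs *)

Definition mutually_independent (R : realType) (d : measure_display)
    (T : measurableType d) (P : probability T R) (J : eqType)
    (X : J -> {RV P >-> (measurableTypeR R)}) : Prop :=
  forall (s : seq J) (A : J -> set R),
    uniq s -> (forall j, measurable (A j)) ->
    P (\bigcap_(j in [set` s]) (X j @^-1` A j)) =
    (\prod_(j <- s) P (X j @^-1` A j))%E.

(* A probability space carrying the demands [chi] of the instance [I] and an
   independent sequence [U] of uniform random numbers. *)
Record random_model (R : realType) (n : nat) (I : instance R n)
    (d : measure_display) (T : measurableType d) (P : probability T R)
    (chi : 'I_n -> {RV P >-> (measurableTypeR R)})
    (U : nat -> {RV P >-> (measurableTypeR R)}) : Prop := RandomModel {
  demand_bounds : forall i x, 0 <= chi i x <= capacity I;
  demand_law : forall i (A : set R), measurable A ->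
    distribution P (chi i) A = law I i A;
  tape_bounds : forall j x, 0 <= U j x <= 1;
  tape_law : forall j (A : set R), measurable A ->
    distribution P (U j) A = uniform_prob (@ltr01 R) A;
  demand_tape_independent :
    mutually_independent (fun k : 'I_n + nat =>
      match k with inl i => chi i | inr j => U j end) }.

Section ExpectedCosts.
Variables (R : realType) (n : nat) (I : instance R n).
Variables (d : measure_display) (T : measurableType d) (P : probability T R).
Variables (chi : 'I_n -> {RV P >-> (measurableTypeR R)}).
Variables (U : nat -> {RV P >-> (measurableTypeR R)}).

(* [pi] is a randomized policy, with seed [U], which almost surely serves all
   customers; the function [Z] is its cost. *)
Definition policy_expected_cost (pi : (nat -> R) -> policy R n) (e : \bar R) :
    Prop :=
  exists Z : T -> R,
    [/\ measurable_fun setT Z,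
        {ae P, forall x,
          policy_cost I (fun i => chi i x) (pi (fun j => U j x)) (Z x)} &
        e = (\int[P]_x (Z x)%:E)%E].

Definition optimal_expected_cost : \bar R :=
  ereal_inf [set e | exists pi, policy_expected_cost pi e].

Definition program_expected_cost (c : prog R (instr R)) (e : \bar R) : Prop :=
  exists Z : T -> R,
    [/\ measurable_fun setT Z,
        {ae P, forall x,
          program_cost I (fun i => chi i x) (fun j => U j x) c (Z x)} &
        e = (\int[P]_x (Z x)%:E)%E].

End ExpectedCosts.

Definition cuvrpsd_approx_algorithm (R : realType) (rho : R)
    (c : prog R (instr R)) : Prop :=
  polynomial_time_policy c /\
  forall (n : nat) (I : instance R n)
    (d : measure_display) (T : measurableType d) (P : probability T R)
    (chi : 'I_n -> {RV P >-> (measurableTypeR R)})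
    (U : nat -> {RV P >-> (measurableTypeR R)}),
    random_model I chi U ->
    exists2 e : \bar R, program_expected_cost I chi U c e &
      (e <= rho%:E * optimal_expected_cost I chi U)%E.

(* Main.v *)
From HB Require Import structures.
From mathcomp Require Import all_boot all_order all_algebra all_fingroup.
From mathcomp Require Import all_classical all_reals all_analysis.
From mathcomp Require Import measurable_realfun.
From mathcomp Require Import ring lra zify.
Require Import Defs.

Set Implicit Arguments.
Unset Strict Implicit.
Unset Printing Implicit Defensive.
Import Order.TTheory GRing.Theory Num.Theory.
Import numFieldNormedType.Exports.
Local Open Scope classical_set_scope.
Local Open Scope ring_scope.

(** The vehicle follows the approximate TSP tour, loaded as if its capacity
    were [c], where [c] is [Q] if [alpha b Q <= 4 a] and [4 a / (alpha b)]
    otherwise, starting with a uniform load in [[0, c]]. A customer whose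
    demand [d] exceeds the load is served by a round trip carrying exactly [d],
    after which the vehicle returns to the customer with its former load minus
    [d] modulo [c] (or with its former load if [d > c]). For fixed demands the
    load thus remains uniform along the tour, so that an edge [e] of the tour
    costs [(a + b c / 2) w e] on average, and a customer at distance [l] adds
    at most [(4 a min (d / c) 1 + 2 b d) l].

    Conversely, for every outcome of the demands, a policy that travels a
    distance [len] pays at least [a len + b eta], where [eta] is the sum of the
    [d l], and [len] is at least the weight of an optimal tour and at least
    [2 eta / Q]. The ratio [alpha + 2] already holds between these two bounds for
    every outcome of the demands, whatever their distribution. *)

(** * Rotations of the unit interval and independence *)

Section Translation.
Variable R : realType.
Local Notation mu := (@lebesgue_measure R).

Lemma lebesgue_measure_shift (t : R) (A : set R) : measurable A ->
  pushforward mu (fun x : measurableTypeR R => x + t : measurableTypeR R) A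
  = mu A.
Proof.
move=> mA.
have ms : measurable_fun setT
    (fun x : measurableTypeR R => x + t : measurableTypeR R).
  exact: measurable_funD.
apply/esym/lebesgue_measure_unique => //= _ [[a b]] _ <-.
rewrite /pushforward (_ : _ @^-1` _ = `]a - t, b - t]%classic).
  rewrite !lebesgue_measure_itv/= !lte_fin ltrD2r -!EFinB.
  by case: ifP => // _; congr (_%:E); ring.
by apply/seteqP; split => x /=; rewrite !in_itv/= ltrBlDr lerBrDr.
Qed.

Lemma ge0_integral_shift (t : R) (D : set R) (f : R -> \bar R) :
  measurable D -> measurable_fun D f -> {in D, forall x, (0 <= f x)%E} ->
  (\int[mu]_(x in [set x | D (x + t)%R]) f (x + t)%R = \int[mu]_(x in D) f x)%E.
Proof.
move=> mD mf f0.
have ms : measurable_fun setT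
    (fun x : measurableTypeR R => x + t : measurableTypeR R).
  exact: measurable_funD.
have := ge0_integral_pushforward ms mu mD mf f0; rewrite /= => <-.
by apply: eq_measure_integral => A mA _; exact: lebesgue_measure_shift.
Qed.

(** Subtraction of [t] on the circle of length 1: the load drops by [t], with 1 added when it would
    become negative. *)
Definition rotate (t u : R) : R := if t <= u then u - t else u - t + 1.

Lemma rotate_itv (t u : R) :
  0 <= t <= 1 -> 0 <= u <= 1 -> 0 <= rotate t u <= 1.
Proof. by move=> ? ?; rewrite /rotate; case: (leP t u) => ?; lra. Qed.

(** Rotation exchanges two intervals by translations: [[t, 1[] goes to [[0, 1 - t[] and [[0, t[] to
    [[1 - t, 1[]. The sign of [f] is controlled on [[0, 1]] only, because trip costs can be negative
    for other loads. *)
Lemma ge0_integral_rotate (t : R) (f : R -> \bar R) : 0 <= t <= 1 ->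
  measurable_fun setT f -> (forall x, 0 <= x <= 1 -> (0 <= f x)%E) ->
  (\int[mu]_(x in `[0%R, 1%R[) f (rotate t x)
   = \int[mu]_(x in `[0%R, 1%R[) f x)%E.
Proof.
move=> t01 mf f0.
have mr : measurable_fun setT (rotate t).
  apply: measurable_fun_ifT; first exact: measurable_fun_ler.
    exact: measurable_funB.
  by apply: measurable_funD => //; exact: measurable_funB.
have split01 (s : R) : 0 <= s <= 1 ->
    `[0%R, 1%R[%classic = `[0%R, s[ `|` `[s, 1%R[ :> set R.
  move=> s01; apply/seteqP; split => x /=; rewrite !in_itv/=.
    by move=> x01; case: (ltP x s) => xs; [left|right]; lra.
  by case; lra.
have dis (s : R) : [disjoint `[0%R, s[%classic & `[s, 1%R[%classic].
  apply/disj_setPS => x /=; rewrite !in_itv/=; lra.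
rewrite [LHS](_ : _ = \int[mu]_(x in `[0%R, t[ `|` `[t, 1%R[)
    f (rotate t x))%E; last by rewrite -split01.
rewrite [LHS]ge0_integral_setU//; last 2 first.
  - by apply: measurable_funTS; apply: measurableT_comp.
  - move=> x; rewrite -split01//= in_itv/= => x01; apply/f0/rotate_itv => //.
    lra.
rewrite [RHS](_ : _ = \int[mu]_(x in `[0%R, (1 - t)%R[ `|`
    `[(1 - t)%R, 1%R[) f x)%E; last first.
  by rewrite -split01; [by []|lra].
rewrite [RHS]ge0_integral_setU//; last 2 first.
  - exact: measurable_funTS.
  - move=> x; rewrite -split01/= ?in_itv/=; last lra.
    by move=> x01; apply: f0; lra.
rewrite addeC; congr (_ + _)%E.
  rewrite -[RHS](ge0_integral_shift (- t)); last 3 first.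
  - by [].
  - exact: measurable_funTS.
  - by move=> x; rewrite inE/= in_itv/= => x01; apply: f0; lra.
  rewrite [in RHS](_ : [set x | _] = `[t, 1%R[%classic); last first.
    by apply/seteqP; split => x/=; rewrite !in_itv/=; lra.
  by apply: eq_integral => x; rewrite inE/= in_itv/= /rotate => /andP[->].
rewrite -[RHS](ge0_integral_shift (1 - t)); last 3 first.
- by [].
- exact: measurable_funTS.
- by move=> x; rewrite inE/= in_itv/= => x01; apply: f0; lra.
rewrite [in RHS](_ : [set x | _] = `[0%R, t[%classic); last first.
  by apply/seteqP; split => x/=; rewrite !in_itv/=; lra.
apply: eq_integral => x; rewrite inE/= in_itv/= /rotate => /andP[_].
by rewrite ltNge => /negbTE ->; congr f; ring.
Qed.

Lemma integral_id (t : R) : 0 <= t ->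
  (\int[mu]_(x in `[0%R, t[) x%:E = (t ^+ 2 / 2)%:E)%E.
Proof.
rewrite le_eqVlt => /predU1P[<-|t0].
  by rewrite set_itvco0 integral_set0 expr0n/= mul0r.
rewrite integral_itv_bndo_bndc//.
rewrite (@continuous_FTC2 _ id (fun x => x ^+ 2 / 2))//.
- by rewrite expr0n/= mul0r oppr0 adde0.
- by apply: continuous_subspaceT => x; exact: cvg_id.
- have d x : derivable (fun x : R => x ^+ 2 / 2) x 1 by exact: derivableM.
  split => //.
  + apply: cvg_at_right_filter.
    by apply: cvgM; [exact: exprn_continuous|exact: cvg_cst].
  + apply: cvg_at_left_filter.
    by apply: cvgM; [exact: exprn_continuous|exact: cvg_cst].
- move=> x _; rewrite derive1E deriveM// ?derive_cst ?scaler0 ?add0r.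
  by rewrite exp_derive expr1 /GRing.scale/=; field.
Qed.

End Translation.

(** * Integrating out an independent variable *)

Section Freezing.
Context d d1 d2 (T : measurableType d) (T1 : measurableType d1)
  (T2 : measurableType d2) (R : realType) (P : probability T R).
Variables (X : {mfun T >-> T1}) (Y : {mfun T >-> T2}).
Hypothesis XY_indep : forall A B, measurable A -> measurable B ->
  P (X @^-1` A `&` Y @^-1` B) = (P (X @^-1` A) * P (Y @^-1` B))%E.

(** By independence the joint law of [X] and [Y] is the product of their laws; Tonelli then
    integrates [X] out for each frozen value of [Y]. *)
Lemma ge0_integral_independent (f : T1 * T2 -> \bar R) :
  measurable_fun setT f -> (forall z, 0 <= f z)%E ->
  (\int[P]_x f (X x, Y x)
   = \int[P]_x \int[distribution P X]_u f (u, Y x))%E.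
Proof.
move=> mf f0.
have mXY : measurable_fun setT (fun x => (X x, Y x)).
  exact: measurable_fun_pair.
transitivity (\int[pushforward P (fun x => (X x, Y x))]_z f z)%E.
  by rewrite ge0_integral_pushforward.
transitivity (\int[distribution P X \x distribution P Y]_z f z)%E.
  apply: eq_measure_integral => A mA _; apply/esym.
  pose mX := isMeasurableFun.Build _ _ _ _ _ mXY.
  pose XY : {mfun T >-> (T1 * T2)%type} := HB.pack (fun x => (X x, Y x)) mX.
  have XYE B C : measurable B -> measurable C ->
      distribution P XY (B `*` C) = (distribution P X B * distribution P Y C)%E.
    by move=> mB mC; rewrite /distribution /pushforward -XY_indep.
  have := product_measure_unique XYE mA. exact.
rewrite fubini_tonelli2//.
by rewrite ge0_integral_distribution//; [exact: measurable_fun_fubini_tonelli_G|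
  move=> y; apply: integral_ge0].
Qed.

End Freezing.

(** * Routes and the lower bound *)

Section Routes.
Variables (R : realType) (n : nat) (w : metric R n.+1).

(** Free endpoints let this describe both the unfinished route of a policy and the part of a tour
    that is still ahead. *)
Fixpoint route_weight (x : 'I_n.+1) (vs : seq 'I_n) (y : 'I_n.+1) : R :=
  if vs is v :: vs' then
    w x (lift ord0 v) + route_weight (lift ord0 v) vs' y
  else w x y.

Lemma route_weight_rcons x vs v y :
  route_weight x (rcons vs v) y =
  route_weight x vs (lift ord0 v) + w (lift ord0 v) y.
Proof. by elim: vs x => //= u vs IH x; rewrite IH addrA. Qed.

Lemma route_weightE x vs y :
  route_weight x vs y =
  \sum_(i < (size vs).+1) w (nth y (x :: map (lift ord0) vs) i)
                            (nth y (rcons (map (lift ord0) vs) y) i).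
Proof.
elim: vs x => [|v vs IH] x /=; first by rewrite big_ord1.
by rewrite big_ord_recl IH.
Qed.

Lemma tour_weight_route (s : {perm 'I_n.+1}) vs : size vs = n ->
  (forall i : 'I_n.+1, s i = nth ord0 (ord0 :: map (lift ord0) vs) i) ->
  tour_weight w s = route_weight ord0 vs ord0.
Proof.
move=> szvs sE; rewrite route_weightE szvs /tour_weight.
apply: eq_bigr => i _; rewrite !sE; congr (w _ _).
rewrite nth_rcons size_map szvs /=; have := ltn_ord i; rewrite ltnS leq_eqVlt.
case/predU1P => [->|lt_in]; first by rewrite modnn ltnn eqxx.
by rewrite modn_small// lt_in.
Qed.

(** Turns the order in which a policy serves the customers into a tour, to be compared with the
    approximate one. *)
Lemma route_perm vs : uniq vs -> (forall i, i \in vs) ->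
  exists s : {perm 'I_n.+1}, tour_weight w s = route_weight ord0 vs ord0.
Proof.
move=> uvs avs.
have szvs : size vs = n.
  by rewrite -(card_uniqP uvs) -[RHS]card_ord; apply: eq_card => i; rewrite avs.
have inj : injective (fun i : 'I_n.+1 =>
    nth ord0 (ord0 :: map (lift ord0) vs) i).
  move=> i j /eqP; rewrite nth_uniq ?/= ?size_map ?szvs//.
    by move=> /eqP; exact: val_inj.
  rewrite map_inj_uniq ?uvs ?andbT//; last exact: lift_inj.
  by apply/mapP => -[k _]; apply/eqP/neq_lift.
by exists (perm inj); apply: tour_weight_route => // i; rewrite permE.
Qed.

Lemma map_lift_pmap (l : seq 'I_n.+1) : ord0 \notin l ->
  map (lift ord0) (pmap (@customer n) l) = l.
Proof.
elim: l => //= v l IH; rewrite inE negb_or => /andP[v0 /IH {}IH].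
rewrite /customer; case: unliftP => [j ->|v0'] /=; first by rewrite IH.
by rewrite v0' eqxx in v0.
Qed.

(* Rotating the cyclic tour [s] so that it starts at the depot. *)
Lemma perm_route (s : {perm 'I_n.+1}) : exists (p : 'I_n.+1) (vs : seq 'I_n),
  [/\ s p = ord0, uniq vs, (forall i, i \in vs),
      (forall (j : 'I_n.+1) t, (t < n)%N ->
        nat_of_ord j = ((p + t.+1) %% n.+1)%N ->
        s j = nth ord0 (map (lift ord0) vs) t) &
      tour_weight w s = route_weight ord0 vs ord0].
Proof.
pose p := (s^-1)%g ord0.
have sp : s p = ord0 by rewrite /p permKV.
(* Addition in ['I_n.+1] is modulo [n.+1], so [s'] is the tour [s] read cyclically from the depot
   on. *)
have inj : injective (fun i : 'I_n.+1 => s (p + i)).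
  by move=> i j /perm_inj /addrI.
pose s' := perm inj.
pose l := [seq s' (lift ord0 i) | i <- enum 'I_n].
have l0 : ord0 \notin l.
  apply/mapP => -[i _]; rewrite permE -{1}sp => /perm_inj /eqP.
  rewrite -{1}[p]addr0 (inj_eq (addrI _)) => /eqP h.
  by move/eqP: (neq_lift ord0 i); apply.
have lE := map_lift_pmap l0.
set vs := pmap _ _ in lE.
have ul : uniq l.
  by rewrite map_inj_uniq ?enum_uniq// => i j /perm_inj /lift_inj.
have uvs : uniq vs by move: ul; rewrite -lE; exact: map_uniq.
have szl : size l = n by rewrite size_map size_enum_ord.
have szvs : size vs = n by rewrite -(size_map (lift ord0)) lE.
have nthl t : (t < n)%N -> nth ord0 l t = s' (inord t.+1).
  move=> tn; rewrite (nth_map (Ordinal tn)) ?size_enum_ord//; congr (s' _).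
  by apply: ord_inj; rewrite inordK// lift0 nth_enum_ord.
exists p, vs; split => //.
- move=> i; have : (size (enum 'I_n) <= size vs)%N.
    by rewrite szvs size_enum_ord.
  by move=> /(uniq_min_size uvs) [j|_ ->]; rewrite mem_enum.
- move=> j t tn jE; rewrite lE nthl// permE; congr (s _).
  by apply: val_inj; rewrite /= inordK.
- rewrite -(@tour_weight_route s')//; last first.
    move=> i; rewrite lE; case: (unliftP ord0 i) => [k ->|->].
      rewrite lift0 /= nthl//; congr (s' _).
      by apply: ord_inj; rewrite inordK ?lift0// ltnS.
    by rewrite permE addr0 sp.
  rewrite /tour_weight (reindex_inj (addrI p)); apply: eq_bigr => i _.
  rewrite !permE; congr (w _ (s _)); apply: val_inj => /=.
  by rewrite modnDmr -[(_ %% _).+1]addn1 modnDml addn1 addnS.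
Qed.

End Routes.

(** * Lower bound on the cost of a policy *)

Section LowerBound.
Variables (R : realType) (n : nat) (I : instance R n) (demand : 'I_n -> R).
Hypothesis demand_ge0 : forall i, 0 <= demand i.
Local Notation radius v := (I ord0 v).

Definition radial_demand : R := \sum_i demand i * radius (lift ord0 i).

(* [len + radius (position s)] includes the way back to the depot: delivering
   [x] units at distance [l] takes up the fraction [x / capacity] of a round
   trip of length at least [2 * l]. *)
Lemma policy_run_bound pi h s : policy_run I demand pi h s ->
  exists len haul vs,
  [/\ spent s = coef_a I * len + coef_b I * haul,
      uniq vs /\ served s = [set i in vs]%SET,
      (forall y, route_weight I ord0 vs y <= len + I (position s) y),
      0 <= load s <= capacity I &
      let q := \sum_(i in served s) demand i * radius (lift ord0 i) +
               load s * radius (position s) in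
      q <= haul /\
      2 * q <= capacity I * (len + radius (position s))].
Proof.
have Q0 := capacity_gt0 I.
elim => [|{}h {}s x s' _ [len [haul [vs [spE [uvs srvE] rt ld [B L]]]]] _].
  exists 0, 0, [::]; rewrite /= weight_refl big_set0; split => //.
  - by rewrite !mulr0 addr0.
  - by move=> y; rewrite add0r.
  - by rewrite lexx ltW.
  - by rewrite !mulr0 !addr0 !mulr0.
case: x => [q|v|] /=.
(* Loading happens at radius 0, so the load term vanishes before and after. *)
- case: ifP => // /andP[/eqP p0 q_itv] [<-] /=.
  exists len, haul, vs; split => //=.
  by move: B L; rewrite p0 weight_refl !mulr0 !addr0.
- move=> [<-] /=; exists (len + I (position s) v).
  exists (haul + load s * I (position s) v), vs; split => //=.
  + by rewrite spE; ring.
  + move=> y; apply: (le_trans (rt y)); rewrite -addrA lerD2l.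
    exact: weight_triangle.
  + have t1 := weight_triangle I ord0 (position s) v.
    have t2 := weight_triangle I ord0 v (position s).
    rewrite (weight_sym I v) in t2.
    set S := \sum_(i in served s) _ in B L *.
    case/andP: ld => ld0 ldQ.
    split; [nra|].
    (* The move increases the slack of the second bound by exactly the sum of the next two
       products. *)
    have : 0 <= (capacity I - load s) *
        (I (position s) v + radius v - radius (position s)).
      by rewrite mulr_ge0//; lra.
    have : 0 <= load s * (I (position s) v + radius (position s) - radius v).
      by rewrite mulr_ge0//; lra.
    nra.
- rewrite /customer; case: unliftP => // i pE.
  case: ifP => // /andP[iS dl] [<-] /=.
  exists len, haul, (rcons vs i).
  have iV : i \notin vs by move: iS; rewrite srvE inE.
  split => //=.
  + rewrite rcons_uniq iV uvs; split => //.
    by rewrite srvE; apply/setP => j; rewrite !inE mem_rcons inE.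
  + move=> y; rewrite route_weight_rcons -pE lerD2r.
    by apply: (le_trans (rt _)); rewrite pE weight_refl addr0.
  + by rewrite subr_ge0 dl/=; have := demand_ge0 i; lra.
  (* A delivery moves demand times radius from the load term to the sum over the served
     customers. *)
  + rewrite big_setU1//= pE; move: B L; rewrite pE.
    set S := \sum_(i in served s) _ => B L.
    by split; lra.
Qed.

(** At the end the vehicle is at the depot with an arbitrary leftover load at radius 0, so the
    invariant bounds [radial_demand] itself, and the order of service closes up to a tour. *)
Lemma policy_cost_ge pi z : policy_cost I demand pi z ->
  exists len, exists2 s : {perm 'I_n.+1},
    tour_weight I s <= len /\ 2 * radial_demand <= capacity I * len &
    coef_a I * len + coef_b I * radial_demand <= z.
Proof.
case=> h [s [/policy_run_bound [len [haul [vs [spE [uvs srvE] rt _ [B L]]]]]]].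
move=> _ [p0 sT] spz.
have [|t tE] := route_perm I uvs.
  move=> i; have : i \in served s by rewrite sT finset.in_setT.
  by rewrite srvE inE.
move: B L; rewrite p0 weight_refl mulr0 !addr0 sT.
rewrite (eq_bigl xpredT) => [|i]; last by rewrite inE.
rewrite -/radial_demand => B L; exists len, t.
  by split => //; rewrite tE; have := rt ord0; rewrite p0 weight_refl addr0.
by rewrite -spz spE lerD2l ler_wpM2l// coef_b_ge0.
Qed.

End LowerBound.

(** * Cost of the randomized tour for fixed demands *)

Section UnitIntegrals.
Variable R : realType.
Local Notation mu := (@lebesgue_measure R).

Lemma eq_integral_itv (t : R) (f g : R -> R) :
  (forall u, 0 <= u < t -> f u = g u) ->
  (\int[mu]_(u in `[0%R, t[) (f u)%:E = \int[mu]_(u in `[0%R, t[) (g u)%:E)%E.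
Proof.
by move=> fg; apply: eq_integral => u; rewrite inE/= in_itv/= => /fg ->.
Qed.

Lemma ge0_integral_itvD (t : R) (f g : R -> R) :
  measurable_fun setT f -> measurable_fun setT g ->
  {in `[0, t[, forall u, 0 <= f u} -> {in `[0, t[, forall u, 0 <= g u} ->
  (\int[mu]_(u in `[0%R, t[) (f u + g u)%:E =
   \int[mu]_(u in `[0%R, t[) (f u)%:E + \int[mu]_(u in `[0%R, t[) (g u)%:E)%E.
Proof.
move=> mf mg f0 g0; under eq_integral do rewrite EFinD.
rewrite ge0_integralD//=.
- by apply/measurable_EFinP; exact: measurable_funTS.
- by apply/measurable_EFinP; exact: measurable_funTS.
Qed.

Lemma integral_affine (t p q : R) : 0 <= t -> 0 <= p -> 0 <= q ->
  (\int[mu]_(u in `[0%R, t[) (p + q * u)%:E = (p * t + q * (t ^+ 2 / 2))%:E)%E.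
Proof.
move=> t0 p0 q0; rewrite ge0_integral_itvD//; last first.
- by move=> u; rewrite in_itv/= => /andP[u0 _]; rewrite mulr_ge0.
rewrite EFinD; congr (_ + _)%E.
  rewrite integral_cst//= lebesgue_measure_itv/= lte_fin.
  move: t0; rewrite le_eqVlt => /predU1P[<-|->].
    by rewrite ltxx mule0 mulr0.
  by rewrite oppr0 adde0 EFinM.
under eq_integral do rewrite EFinM.
rewrite ge0_integralZl//=; first by rewrite integral_id.
by move=> u; rewrite in_itv/= => /andP[u0 _]; rewrite lee_fin.
Qed.

End UnitIntegrals.

(** * Cost of the tour as a function of the initial load *)

Section TripCost.
Variables (R : realType) (n : nat) (I : instance R n) (c : R).
Local Notation a := (coef_a I).
Local Notation b := (coef_b I).
Local Notation radius v := (I ord0 (lift ord0 v)).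

(** The rotation that serving a demand [d] causes on the load divided by [c]; it is 0 for
    [d = c = 0]. *)
Definition offset (d : R) : R := if d <= c then d / c else 0.

(** The minimum of [d / c] and 1: the probability that a uniform load in [[0, c]] is smaller than
    [d]. *)
Definition detour_prob (d : R) : R := if d <= c then d / c else 1.

(* [u] is the load divided by [c]; the four legs of the detour carry [c * u],
   [d], nothing, and the load with which the tour is resumed. *)
Definition detour_cost (v : 'I_n) (d u : R) : R :=
  if d <= c * u then 0 else
  (4 * a + b * (c * u + d + c * rotate (offset d) u)) * radius v.

Fixpoint trip_cost (demand : 'I_n -> R) (x : 'I_n.+1) (vs : seq 'I_n) (u : R) :
    R :=
  if vs is v :: vs' then
    (a + b * (c * u)) * I x (lift ord0 v) + detour_cost v (demand v) u +
    trip_cost demand (lift ord0 v) vs' (rotate (offset (demand v)) u)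
  else (a + b * (c * u)) * I x ord0.

Section Measurability.
Context (d : measure_display) (T : measurableType d).

Lemma measurable_rotate (f g : T -> R) :
  measurable_fun setT f -> measurable_fun setT g ->
  measurable_fun setT (fun x => rotate (f x) (g x)).
Proof.
move=> mf mg; apply: measurable_fun_ifT; first exact: measurable_fun_ler.
  exact: measurable_funB.
by apply: measurable_funD => //; exact: measurable_funB.
Qed.

Lemma measurable_offset (f : T -> R) : measurable_fun setT f ->
  measurable_fun setT (fun x => offset (f x)).
Proof.
move=> mf; apply: measurable_fun_ifT => //; first exact: measurable_fun_ler.
exact: measurable_funM.
Qed.

Lemma measurable_detour_cost v (f g : T -> R) :
  measurable_fun setT f -> measurable_fun setT g ->
  measurable_fun setT (fun x => detour_cost v (f x) (g x)).
Proof.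
move=> mf mg; apply: measurable_fun_ifT => //.
  by apply: measurable_fun_ler => //; exact: measurable_funM.
apply: measurable_funM => //; apply: measurable_funD => //.
apply: measurable_funM => //; apply: measurable_funD.
  by apply: measurable_funD => //; exact: measurable_funM.
apply: measurable_funM => //; apply: measurable_rotate => //.
exact: measurable_offset.
Qed.

(** Demands and load vary together over an arbitrary space: this covers fixed demands, the product
    of a draw with [demand_space], and the original probability space. *)
Lemma measurable_trip_cost (chi : 'I_n -> T -> R) x vs (f : T -> R) :
  (forall i, measurable_fun setT (chi i)) -> measurable_fun setT f ->
  measurable_fun setT (fun y => trip_cost (chi^~ y) x vs (f y)).
Proof.
move=> mchi; elim: vs x f => [|v vs IH] x f mf /=.
  apply: measurable_funM => //; apply: measurable_funD => //.
  by apply: measurable_funM => //; exact: measurable_funM.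
apply: measurable_funD; last first.
  by apply: IH; apply: measurable_rotate => //; exact: measurable_offset.
apply: measurable_funD; last exact: measurable_detour_cost.
apply: measurable_funM => //; apply: measurable_funD => //.
by apply: measurable_funM => //; exact: measurable_funM.
Qed.

End Measurability.

Hypothesis c_ge0 : 0 <= c.
Let a_ge0 := coef_a_ge0 I.
Let b_ge0 := coef_b_ge0 I.

Lemma offset_itv d : 0 <= d -> 0 <= offset d <= 1.
Proof.
rewrite /offset => d0; case: (leP d c) => dc; last by rewrite lexx ler01.
rewrite divr_ge0//=; move: c_ge0; rewrite le_eqVlt => /predU1P[<-|c0].
  by rewrite invr0 mulr0 ler01.
by rewrite ler_pdivrMr// mul1r.
Qed.

Lemma detour_cost_ge0 v d u : 0 <= d -> 0 <= u <= 1 -> 0 <= detour_cost v d u.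
Proof.
move=> d0 u01; rewrite /detour_cost; case: ifP => // _.
have /andP[r0 _] := rotate_itv (offset_itv d0) u01.
case/andP: u01 => u0 _.
by rewrite mulr_ge0 ?weight_ge0// addr_ge0 ?mulr_ge0// !addr_ge0// mulr_ge0.
Qed.

Lemma edge_cost_ge0 x y u : 0 <= u -> 0 <= (a + b * (c * u)) * I x y.
Proof. by move=> u0; rewrite mulr_ge0 ?weight_ge0// addr_ge0// !mulr_ge0. Qed.

Lemma trip_cost_ge0 demand x vs u : (forall i, 0 <= demand i) ->
  0 <= u <= 1 -> 0 <= trip_cost demand x vs u.
Proof.
move=> d0; elim: vs x u => [|v vs IH] x u u01 /=.
  by apply: edge_cost_ge0; lra.
rewrite !addr_ge0 ?detour_cost_ge0//; first by apply: edge_cost_ge0; lra.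
by rewrite IH// rotate_itv// offset_itv.
Qed.

Local Notation mu := (@lebesgue_measure R).

Lemma integral_edge_cost x y :
  (\int[mu]_(u in `[0%R, 1%R[) ((a + b * (c * u)) * I x y)%:E =
   ((a + b * c / 2) * I x y)%:E)%E.
Proof.
rewrite (@eq_integral_itv _ 1 _ (fun u => a * I x y + b * c * I x y * u)).
  by rewrite integral_affine ?mulr_ge0 ?weight_ge0//; congr (_%:E); field.
by move=> u _; ring.
Qed.

(* The load at [v] being uniform in [[0, c]], the detour is made with
   probability [detour_prob d], and then the loads on its first and last legs
   add up to [c] on average. *)
Lemma integral_detour_cost v d : 0 <= d ->
  (\int[mu]_(u in `[0%R, 1%R[) (detour_cost v d u)%:E <=
   ((4 * a * detour_prob d + 2 * b * d) * radius v)%:E)%E.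
Proof.
move=> d0; have r0 : 0 <= radius v by exact: weight_ge0.
rewrite /detour_cost /detour_prob /offset; case: (leP d c) => dc; last first.
  (* For [d > c] the detour is certain and preserves the load; its first and last legs together
     carry [c] on average, which is less than [d]. *)
  rewrite (@eq_integral_itv _ 1 _ (fun u =>
      (4 * a + b * d) * radius v + 2 * b * c * radius v * u)); last first.
    move=> u /andP[u0 u1].
    rewrite leNgt (le_lt_trans _ dc)/=; last by rewrite ler_piMr// ltW.
    by rewrite /rotate u0 subr0; ring.
  rewrite integral_affine ?mulr_ge0 ?addr_ge0 ?mulr_ge0// lee_fin.
  rewrite expr1n mul1r mulr1.
  have : 0 <= b * radius v * (d - c) by rewrite !mulr_ge0// subr_ge0 ltW.
  by lra.
move: c_ge0; rewrite le_eqVlt => /predU1P[c0|c0].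
  have dE : d = 0 by apply/eqP; rewrite eq_le d0 andbT c0.
  rewrite integral0_eq => [|u _].
    by rewrite lee_fin dE !(mul0r, mulr0, addr0).
  by rewrite dE -c0 mul0r lexx.
set t := d / c.
have cE : c * t = d by rewrite /t mulrCA divff ?mulr1// gt_eqF.
have t01 : 0 <= t <= 1 by have := offset_itv d0; rewrite /offset dc.
rewrite (_ : `[0%R, 1%R[%classic = `[0%R, t[ `|` `[t, 1%R[); last first.
  apply/seteqP; split => x /=; rewrite !in_itv/=.
    by move=> x01; case: (ltP x t) => xs; [left|right]; lra.
  by case; lra.
have mD : measurable_fun setT (fun u : R => if d <= c * u then 0 else
    (4 * a + b * (c * u + d + c * rotate t u)) * radius v).
  have := @measurable_detour_cost _ R v (cst d) id.
  by rewrite /detour_cost/= /offset/= dc; apply.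
rewrite ge0_integral_setU//; last 3 first.
- by apply/measurable_EFinP; exact: measurable_funTS.
- move=> u /= uI; have u01 : 0 <= u <= 1.
    by case: uI; rewrite in_itv/=; lra.
  by have := detour_cost_ge0 v d0 u01; rewrite lee_fin /detour_cost /offset dc.
- by apply/disj_setPS => x /=; rewrite !in_itv/=; lra.
rewrite [X in (_ + X)%E]integral0_eq ?adde0; last first.
  by move=> u; rewrite /= in_itv/= => /andP[tu _]; rewrite -cE ler_pM2l// tu.
(* For [u < t] the rotation adds 1, so the loads [c * u], [d = c * t] and [c * (u - t + 1)] sum to
   [c + 2 * c * u]. *)
rewrite (@eq_integral_itv _ t _ (fun u =>
    (4 * a + b * c) * radius v + 2 * b * c * radius v * u)); last first.
  move=> u /andP[_ ut].
  rewrite -{1}cE ler_pM2l// leNgt ut/= /rotate leNgt ut/= -cE.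
  by ring.
case/andP: t01 => t0 t1; clearbody t.
rewrite integral_affine ?mulr_ge0 ?addr_ge0 ?mulr_ge0// lee_fin -cE.
(* The slack comes from the leg carrying [d], which is made with probability [t] only. *)
have : 0 <= b * radius v * (c * t) * (1 - t).
  by rewrite cE !mulr_ge0// subr_ge0.
by lra.
Qed.

(** Induction along the route: beyond [v] the load is a rotation of a uniform load, hence again
    uniform. *)
Lemma integral_trip_cost demand x vs : (forall i, 0 <= demand i) ->
  (\int[mu]_(u in `[0%R, 1%R[) (trip_cost demand x vs u)%:E <=
   ((a + b * c / 2) * route_weight I x vs ord0 +
    \sum_(v <- vs) (4 * a * detour_prob (demand v) + 2 * b * demand v) *
                   radius v)%:E)%E.
Proof.
move=> d0; elim: vs x => [|v vs IH] x /=.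
  by rewrite integral_edge_cost big_nil addr0.
have mT p vs' : measurable_fun setT (trip_cost demand p vs').
  exact: (@measurable_trip_cost _ R (fun i _ => demand i) p vs' id).
have mrot : measurable_fun setT (rotate (offset (demand v))).
  exact: (@measurable_rotate _ R (cst (offset (demand v))) id).
have me : measurable_fun setT (fun u => (a + b * (c * u)) * I x (lift ord0 v)).
  apply: measurable_funM => //; apply: measurable_funD => //.
  by apply: measurable_funM => //; exact: measurable_funM.
have md : measurable_fun setT (detour_cost v (demand v)).
  exact: (@measurable_detour_cost _ R v (cst (demand v)) id).
have itv01 (u : R) : u \in `[0, 1[ -> 0 <= u <= 1 by rewrite in_itv/=; lra.
have e0 : {in `[0, 1[, forall u, 0 <= (a + b * (c * u)) * I x (lift ord0 v)}.
  by move=> u /itv01 /andP[u0 _]; exact: edge_cost_ge0.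
have dc0 : {in `[0, 1[, forall u : R, 0 <= detour_cost v (demand v) u}.
  by move=> u /itv01; exact: detour_cost_ge0.
rewrite ge0_integral_itvD; last 4 first.
- exact: measurable_funD.
- exact: measurableT_comp.
- by move=> u u01; rewrite addr_ge0 ?e0 ?dc0.
- move=> u /itv01 u01; apply: trip_cost_ge0 => //.
  by rewrite rotate_itv// offset_itv.
rewrite ge0_integral_itvD// integral_edge_cost.
rewrite (ge0_integral_rotate
  (f := fun u => (trip_cost demand (lift ord0 v) vs u)%:E)); last 3 first.
- exact: offset_itv.
- exact/measurable_EFinP.
- by move=> u u01; rewrite lee_fin trip_cost_ge0.
apply: (le_trans (leeD (leeD (lexx _) (integral_detour_cost v (d0 v))) (IH _))).
by rewrite lee_fin big_cons; lra.
Qed.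

End TripCost.

(** * The program and its execution *)

Section WeakestPrecondition.
Variables (R A S : Type) (test : S -> bexp R -> bool).
Variable astep : A -> S -> nat -> S -> Prop.
Implicit Types (c : prog R A) (P : S -> Prop).
Local Notation exec := (exec test astep).

(** Termination, running time and result are proved together, by one symbolic execution. *)
Definition wp c (t : nat) P (s : S) : Prop :=
  exists t' s', [/\ exec c s t' s', (t' <= t)%N & P s'].

Lemma exec_seqP c1 c2 s t s2 : exec (Seq c1 c2) s t s2 ->
  exists t1 t2 s1, [/\ exec c1 s t1 s1, exec c2 s1 t2 s2 & t = (t1 + t2)%N].
Proof. by move=> h; inversion h; subst; exists t1, t2, s1. Qed.

Lemma wp_leq c t t' P s : (t' <= t)%N -> wp c t' P s -> wp c t P s.
Proof.
move=> le [t1 [s' [e le1 Ps']]]; exists t1, s'; split => //.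
exact: leq_trans le1 le.
Qed.

Lemma wp_seq c1 c2 t1 t2 s s1 P : exec c1 s t1 s1 -> wp c2 t2 P s1 ->
  wp (Seq c1 c2) (t1 + t2) P s.
Proof.
move=> e1 [t' [s' [e2 le Ps']]]; exists (t1 + t')%N, s'; split => //.
  exact: exec_seq e1 e2.
by rewrite leq_add2l.
Qed.

(** Brings the first instruction of a nested block to the front, where the other rules apply. *)
Lemma wp_assoc c1 c2 c3 t P s :
  wp (Seq c1 (Seq c2 c3)) t P s -> wp (Seq (Seq c1 c2) c3) t P s.
Proof.
move=> [_ [s' [/exec_seqP[t1 [t23 [s1 [e1 e23 ->]]]] + Ps']]].
have [t2 [t3 [s2 [e2 e3 ->]]]] := exec_seqP e23.
rewrite addnA => le; exists (t1 + t2 + t3)%N, s'; split => //.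
exact: exec_seq (exec_seq e1 e2) e3.
Qed.

Lemma wp_skip c t P s : wp c t P s -> wp (Seq Skip c) t.+1 P s.
Proof. by rewrite -add1n; apply: wp_seq; exact: exec_skip. Qed.

Lemma wp_do i c t P s s' : astep i s 1 s' -> wp c t P s' ->
  wp (Seq (Do R i) c) t.+1 P s.
Proof. by move=> st; rewrite -add1n; apply: wp_seq; exact: exec_do. Qed.

Lemma wp_do_last i P s s' : astep i s 1 s' -> P s' -> wp (Do R i) 1 P s.
Proof. by move=> st Ps'; exists 1%N, s'; split => //; exact: exec_do. Qed.

Lemma wp_if b c1 c2 c t P s :
  wp (Seq (if test s b then c1 else c2) c) t P s ->
  wp (Seq (If b c1 c2) c) t.+1 P s.
Proof.
move=> [_ [s' [/exec_seqP[t1 [t2 [s1 [e1 e2 ->]]]] le Ps']]].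
exists (t1 + t2).+1, s'; split => //; rewrite -addSn.
apply: exec_seq e2.
by case: ifPn e1 => [tb|/negbTE tb]; [exact: exec_if_true|exact: exec_if_false].
Qed.

Lemma wp_while_true b c1 c t P s : test s b ->
  wp (Seq c1 (Seq (While b c1) c)) t P s -> wp (Seq (While b c1) c) t.+1 P s.
Proof.
move=> tb.
move=> [_ [s' [/exec_seqP[t1 [t23 [s1 [e1 e23 ->]]]] + Ps']]].
have [t2 [t3 [s2 [e2 e3 ->]]]] := exec_seqP e23.
rewrite addnA => le; exists (t1 + t2 + t3).+1, s'; split => //.
by rewrite -addSn; apply: exec_seq e3; exact: exec_while_true e1 e2.
Qed.

Lemma wp_while_false b c1 c t P s : ~~ test s b ->
  wp c t P s -> wp (Seq (While b c1) c) t.+1 P s.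
Proof.
by move=> /negbTE tb; rewrite -add1n; apply: wp_seq; exact: exec_while_false.
Qed.

End WeakestPrecondition.

Fixpoint prog_map (R A B : Type) (f : A -> B) (c : prog R A) : prog R B :=
  match c with
  | Skip => Skip
  | Do i => Do R (f i)
  | Seq c1 c2 => Seq (prog_map f c1) (prog_map f c2)
  | If b c1 c2 => If b (prog_map f c1) (prog_map f c2)
  | While b c1 => While b (prog_map f c1)
  end.

Lemma online_exec_compute (R : realType) n (I : instance R n) demand tape c
    m t m' k s :
  offline_exec I c m t m' ->
  online_exec I demand tape (prog_map (@Compute R) c)
    (State m k s) t (State m' k s).
Proof.
rewrite /offline_exec /online_exec; elim => /=.
- by move=> *; exact: exec_skip.
- by move=> *; apply: exec_do; exact: step_compute.
- by move=> *; apply: exec_seq; eassumption.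
- by move=> *; exact: exec_if_true.
- by move=> *; exact: exec_if_false.
- by move=> *; apply: exec_while_true; eassumption.
- by move=> *; exact: exec_while_false.
Qed.

(** * The program *)

Section Program.
Variable R : realType.
Local Notation instr_prog := (prog R (instr R)).

(* The tour occupies the natural number registers below the number of
   vertices. *)
Definition index_addr := NSize.
Definition count_addr := NAdd NSize (NLit 1).
Definition index := NGet index_addr.
Definition count := NGet count_addr.
Definition vertex := NGet index.
Definition cap_reg : rexp R := RGet _ (NLit 0).
Definition load_reg : rexp R := RGet _ (NLit 1).
Definition demand_reg : rexp R := RGet _ (NLit 2).
Definition a_reg : rexp R := RGet _ (NLit 3).
Definition b_reg : rexp R := RGet _ (NLit 4).
Definition Q_reg : rexp R := RGet _ (NLit 5).
Definition nset d e : instr_prog := Do R (Compute (NSet R d e)).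
Definition rset k (e : rexp R) : instr_prog := Do R (Compute (RSet (NLit k) e)).
Definition act (i : instr R) : instr_prog := Do R i.
Definition positive e : bexp R := BNot (NLe R e (NLit 0)).

(** The depot may stand anywhere in the TSP tour; service starts from its index. *)
Definition find_depot : instr_prog :=
  While (positive vertex) (nset index_addr (NAdd index (NLit 1))).

(** [load_reg] keeps the load on arrival while the goods are exchanged at the depot and then,
    corrected modulo the cap, gives the load with which the tour resumes. *)
Definition detour : instr_prog :=
  Seq (act (ActMove R (NLit 0)))
  (Seq (act (ActLoad demand_reg))
  (Seq (act (ActMove R vertex))
  (Seq (act (@ActDeliver R))
  (Seq (act (ActMove R (NLit 0)))
  (Seq (If (RLe demand_reg cap_reg)
          (rset 1 (RAdd (RSub load_reg demand_reg) cap_reg)) Skip)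
  (Seq (act (ActLoad load_reg))
       (act (ActMove R vertex)))))))).

Definition visit : instr_prog :=
  Seq (nset count_addr (NSub count (NLit 1)))
  (Seq (nset index_addr (NAdd index (NLit 1)))
  (Seq (If (NLe R NSize index) (nset index_addr (NLit 0)) Skip)
  (Seq (act (ActMove R vertex))
  (Seq (act (Sense R (NLit 2)))
       (If (RLe demand_reg load_reg)
          (Seq (act (@ActDeliver R)) (rset 1 (RSub load_reg demand_reg)))
          detour))))).

Definition serve : instr_prog :=
  Seq (While (positive count) visit) (act (ActMove R (NLit 0))).

Definition setup (alpha : R) (c : instr_prog) : instr_prog :=
  Seq (act (Param R (NLit 3) ParamA))
  (Seq (act (Param R (NLit 4) ParamB))
  (Seq (act (Param R (NLit 5) ParamQ))
  (Seq (If (RLe (RMul (RMul (RLit alpha) b_reg) Q_reg) (RMul (RLit 4) a_reg))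
          (rset 0 Q_reg)
          (rset 0 (RDiv (RMul (RLit 4) a_reg) (RMul (RLit alpha) b_reg))))
  (Seq (act (Draw R (NLit 1)))
  (Seq (rset 1 (RMul cap_reg load_reg))
  (Seq (act (ActLoad load_reg))
  (Seq (nset index_addr (NLit 0))
  (Seq (nset count_addr (NSub NSize (NLit 1)))
       c)))))))).

Definition algorithm (alpha : R) (tsp : prog R (assign R)) : instr_prog :=
  Seq (prog_map (@Compute R) tsp) (setup alpha (Seq find_depot serve)).

(** The second value solves [alpha * coef_b I * c = 4 * coef_a I]. Comparing products first makes
    the division safe: its denominator is positive whenever it is used. *)
Definition cap (alpha : R) n (I : instance R n) : R :=
  if alpha * coef_b I * capacity I <= 4 * coef_a I then capacity I
  else 4 * coef_a I / (alpha * coef_b I).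

End Program.

(** * Symbolic execution of the program *)

Section Correctness.
Variables (R : realType) (n : nat) (I : instance R n).
Variables (demand : 'I_n -> R) (tape : nat -> R) (c : R).
Variable tau : 'I_n.+1 -> 'I_n.+1.
Hypothesis demand_itv : forall i, 0 <= demand i <= capacity I.
Hypothesis c_itv : 0 <= c <= capacity I.
Local Notation N := n.+1.
Local Notation wp := (wp (fun s => beval I (memory s))
                         (instr_step I demand tape)).

(** Registers 3 to 5 are absent: they are read only while the cap is computed. *)
Record mem_ok (m : mem R) (j k : nat) (L x : R) : Prop := MemOk {
  ok_tour : forall i : 'I_N, nreg m i = tau i;
  ok_index : nreg m N = j;
  ok_count : nreg m (N + 1) = k;
  ok_cap : rreg m 0 = c;
  ok_load : rreg m 1 = L;
  ok_demand : rreg m 2 = x }.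

Section Steps.
Variables (m : mem R) (j k : nat) (L x : R) (ok : mem_ok m j k L x).
Variables (q : nat) (s : vehicle R n) (cont : prog R (instr R)) (t : nat).
Variable P : state R n -> Prop.

Lemma wp_set_index j' e : neval N m e = j' ->
  (forall m', mem_ok m' j' k L x -> wp cont t P (State m' q s)) ->
  wp (Seq (nset R index_addr e) cont) t.+1 P (State m q s).
Proof.
move=> eE h; case: ok => o1 o2 o3 o4 o5 o6.
apply: wp_do; first by apply: step_compute; exact: step_nset.
apply: h; split => //=.
- by move=> i; rewrite /update ltn_eqF.
- by rewrite /update eqxx.
- by rewrite /update -[X in _ == X]addn0 eqn_add2l o3.
Qed.

Lemma wp_set_count k' e : neval N m e = k' ->
  (forall m', mem_ok m' j k' L x -> wp cont t P (State m' q s)) ->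
  wp (Seq (nset R count_addr e) cont) t.+1 P (State m q s).
Proof.
move=> eE h; case: ok => o1 o2 o3 o4 o5 o6.
apply: wp_do; first by apply: step_compute; exact: step_nset.
apply: h; split => //=.
- by move=> i; rewrite /update ltn_eqF// ltn_addr.
- by rewrite /update -[X in X == _]addn0 eqn_add2l o2.
- by rewrite /update eqxx.
Qed.

Lemma wp_set_load L' e : reval I m e = L' ->
  (forall m', mem_ok m' j k L' x -> wp cont t P (State m' q s)) ->
  wp (Seq (rset 1 e) cont) t.+1 P (State m q s).
Proof.
move=> eE h; case: ok => o1 o2 o3 o4 o5 o6.
apply: wp_do; first by apply: step_compute; exact: step_rset.
by apply: h; split => //=; rewrite /update eqxx.
Qed.

Lemma wp_sense i : position s = lift ord0 i ->
  (forall m', mem_ok m' j k L (demand i) -> wp cont t P (State m' q s)) ->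
  wp (Seq (act (Sense R (NLit 2))) cont) t.+1 P (State m q s).
Proof.
move=> pE h; case: ok => o1 o2 o3 o4 o5 o6.
apply: wp_do; first apply: (@step_sense _ _ _ _ _ _ _ _ _ (demand i)).
  by rewrite /revealed pE /customer liftK.
by apply: h; split.
Qed.

End Steps.

Lemma move_step m q e (v : 'I_N) x L S z : neval N m e = v ->
  instr_step I demand tape (ActMove R e) (State m q (Vehicle x L S z)) 1
    (State m q (Vehicle v L S (z + (coef_a I + coef_b I * L) * I x v))).
Proof.
move=> eE; apply: (@step_move _ _ _ _ _ _ _ _ _ _ v) => //=.
by congr (Some (Vehicle _ _ _ _)); ring.
Qed.

Lemma load_step m q e L L' S z : reval I m e = L' -> 0 <= L' <= capacity I ->
  instr_step I demand tape (ActLoad e) (State m q (Vehicle ord0 L S z)) 1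
    (State m q (Vehicle ord0 L' S z)).
Proof. by move=> eE L_itv; apply: step_load; rewrite /= eE L_itv. Qed.

Lemma deliver_step m q i L (S : {set 'I_n}) z : i \notin S -> demand i <= L ->
  instr_step I demand tape (@ActDeliver R)
    (State m q (Vehicle (lift ord0 i) L S z)) 1
    (State m q (Vehicle (lift ord0 i) (L - demand i) (i |: S)%SET z)).
Proof.
by move=> iS dL; apply: step_deliver; rewrite /= /customer liftK iS dL.
Qed.

(** Identifies the rotation with the arithmetic of the program. If [c = 0] then [d = 0] and both
    sides vanish. *)
Lemma load_offset d u : 0 <= d -> 0 <= u -> d <= c ->
  c * rotate (offset c d) u = if d <= c * u then c * u - d else c * u - d + c.
Proof.
move=> d0 u0 dc; rewrite /offset dc; case/andP: c_itv; rewrite le_eqVlt.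
case/predU1P => [c0|c_gt0] _.
  have -> : d = 0 by apply/eqP; rewrite eq_le d0 andbT c0.
  by rewrite -c0 !mul0r lexx subr0.
have -> : d <= c * u = (d / c <= u) by rewrite ler_pdivrMr// mulrC.
by rewrite /rotate; case: ifP => _; field; rewrite gt_eqF.
Qed.

(** With or without a detour the load ends as the rotation, so all branches reach the same
    continuation. The 16 steps are those of a detour: 4 up to the wrap-around of the index, 12 from
    there on. *)
Lemma visit_exec m j k u x q p (S : {set 'I_n}) z (v : 'I_n) (i' : 'I_N)
    cont t P :
  mem_ok m j k.+1 (c * u) x -> (j < N)%N -> nat_of_ord i' = (j.+1 %% N)%N ->
  tau i' = lift ord0 v -> v \notin S -> 0 <= u <= 1 ->
  (forall m', mem_ok m' (j.+1 %% N) k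
      (c * rotate (offset c (demand v)) u) (demand v) ->
    wp cont t P (State m' q (Vehicle (lift ord0 v)
      (c * rotate (offset c (demand v)) u) (v |: S)%SET
      (z + ((coef_a I + coef_b I * (c * u)) * I p (lift ord0 v) +
            detour_cost I c v (demand v) u))))) ->
  wp (Seq (visit R) cont) (16 + t) P (State m q (Vehicle p (c * u) S z)).
Proof.
move=> ok jN i'E ti' vS u01 h; have du := demand_itv v.
have [d0 dQ] := andP du; have [u0 u1] := andP u01; have [c0 cQ] := andP c_itv.
have cu_itv : 0 <= c * u <= capacity I.
  rewrite mulr_ge0//=; apply: le_trans cQ; by rewrite ler_piMr.
apply: wp_assoc; apply: (wp_set_count ok (k' := k)).
  by rewrite /= (ok_count ok) subn1.
move=> {ok} m1 ok; apply: wp_assoc; apply: (wp_set_index ok (j' := j.+1)).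
  by rewrite /= (ok_index ok) addn1.
move=> {ok} m2 ok; apply: wp_assoc; apply: wp_if => /=.
rewrite (ok_index ok).
have tail m3 : mem_ok m3 (j.+1 %% N) k (c * u) x ->
  wp (Seq (Seq (act (ActMove R vertex))
    (Seq (act (Sense R (NLit 2)))
       (If (RLe (demand_reg R) (load_reg R))
          (Seq (act (@ActDeliver R))
               (rset 1 (RSub (load_reg R) (demand_reg R))))
          (detour R)))) cont) (12 + t) P (State m3 q (Vehicle p (c * u) S z)).
  move=> {}ok; have vE m' L' x' : mem_ok m' (j.+1 %% N) k L' x' ->
      neval N m' vertex = lift ord0 v.
    by move=> ok'; rewrite /= (ok_index ok') -i'E (ok_tour ok') ti'.
  apply: wp_assoc; apply: wp_do; first by apply: move_step; exact: vE ok.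
  apply: wp_assoc; apply: (wp_sense ok); first by [].
  move=> {ok} m4 ok; apply: wp_if => /=.
  rewrite (ok_demand ok) (ok_load ok); case: ifPn => dL.
    apply: (@wp_leq _ _ _ _ _ _ _ (2 + t)); first lia.
    apply: wp_assoc; apply: wp_do; first exact: deliver_step.
    apply: (wp_set_load ok) => [/=|m5 ok5].
      by rewrite (ok_load ok) (ok_demand ok).
    (* A direct delivery implies [demand v <= c], so the offset is the quotient by [c]. *)
    have dc : demand v <= c by apply: le_trans dL _; rewrite ler_piMr.
    have LE := load_offset d0 u0 dc; rewrite dL in LE.
    rewrite -LE in ok5 *.
    move: (h _ ok5); rewrite /detour_cost dL.
    by rewrite addr0.
  apply: wp_assoc; apply: wp_do; first by apply: (@move_step _ _ _ ord0).
  apply: wp_assoc; apply: wp_do.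
    by apply: (@load_step _ _ _ _ (demand v)) => //=; rewrite (ok_demand ok).
  apply: wp_assoc; apply: wp_do; first by apply: move_step; exact: vE ok.
  apply: wp_assoc; apply: wp_do; first exact: deliver_step.
  apply: wp_assoc; apply: wp_do; first by apply: (@move_step _ _ _ ord0).
  apply: wp_assoc; apply: wp_if => /=.
  rewrite (ok_demand ok) (ok_cap ok).
  set L' := c * rotate (offset c (demand v)) u.
  have L'_itv : 0 <= L' <= capacity I.
    have /andP[r0 r1] := rotate_itv (offset_itv c0 d0) u01.
    by rewrite /L' mulr_ge0//=; apply: le_trans cQ; rewrite ler_piMr.
  have tail5 m5 : mem_ok m5 (j.+1 %% N) k L' (demand v) ->
    forall Z, Z = z + (coef_a I + coef_b I * (c * u)) * I p (lift ord0 v) +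
      (coef_a I + coef_b I * (c * u)) * I (lift ord0 v) ord0 +
      (coef_a I + coef_b I * demand v) * I ord0 (lift ord0 v) +
      (coef_a I + coef_b I * (demand v - demand v)) * I (lift ord0 v) ord0 ->
    wp (Seq (Seq (act (ActLoad (load_reg R))) (act (ActMove R vertex))) cont)
      (2 + t) P
      (State m5 q (Vehicle ord0 (demand v - demand v) (v |: S)%SET Z)).
    move=> ok5 Z ->; apply: wp_assoc; apply: wp_do.
      by apply: (@load_step _ _ _ _ L') => //=; rewrite (ok_load ok5).
    apply: wp_do; first by apply: move_step; exact: vE ok5.
    move: (h _ ok5); rewrite /detour_cost (negbTE dL) -/L'.
    set Z1 := z + _; set Z2 := _ + _; suff -> : Z1 = Z2 by [].
    by rewrite /Z1 /Z2 (weight_sym I _ ord0); ring.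
  case: ifPn => dc.
    apply: (wp_set_load ok (L' := L')) => [/=|m5 ok5]; last exact: tail5.
    rewrite (ok_load ok) (ok_demand ok) (ok_cap ok) /L' load_offset//.
    by rewrite (negbTE dL).
  apply: wp_skip; apply: tail5 => //.
  suff -> : L' = c * u by [].
  by rewrite /L' /offset (negbTE dc) /rotate u0 subr0.
case: ifPn => jn.
  apply: (wp_set_index ok (j' := (j.+1 %% N)%N)) => //=.
  by have -> : j.+1 = N; [lia | rewrite modnn].
apply: wp_skip; apply: tail; rewrite modn_small//; lia.
Qed.

(** Induction on the customers ahead in the cyclic order. Each takes one loop test and 16 steps; the
    last 2 steps are the failing test and the move home. *)
Lemma serve_exec m j u x (q : nat) (p : 'I_N) (S : {set 'I_n}) z
    (vs : seq 'I_n) :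
  mem_ok m j (size vs) (c * u) x -> (j < N)%N -> uniq vs ->
  S = (~: [set i in vs])%SET -> 0 <= u <= 1 ->
  (forall (i : 'I_N) t, (t < size vs)%N ->
    nat_of_ord i = ((j + t.+1) %% N)%N ->
    tau i = nth ord0 (map (lift ord0) vs) t) ->
  wp (serve R) (17 * size vs + 2)%N
    (fun s => complete (truck s) /\
              spent (truck s) = z + trip_cost I c demand p vs u)
    (State m q (Vehicle p (c * u) S z)).
Proof.
elim: vs m j u x p S z => [|v vs IH] m j u x p S z ok jN uvs SE u01 tvs.
  apply: wp_while_false; first by rewrite /= (ok_count ok).
  apply: wp_do_last; first exact: (@move_step _ _ _ ord0).
  split => //; split => //=.
  by rewrite SE; apply/setP => i; rewrite !inE.
move: uvs => /= /andP[vvs uvs].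
have i'N : (j.+1 %% N < N)%N by rewrite ltn_mod.
rewrite (_ : _ + 2 = (16 + (17 * size vs + 2)).+1)%N; last by rewrite /=; lia.
apply: wp_while_true; first by rewrite /= (ok_count ok).
apply: (@visit_exec _ _ _ _ _ _ _ _ _ v (Ordinal i'N)  _ _ _ ok) => //.
- by rewrite (tvs _ 0%N)//= addn1.
- by rewrite SE !inE eqxx.
move=> m' ok'; have [d0 _] := andP (demand_itv v).
have [c0 _] := andP c_itv.
rewrite /= addrA; apply: (IH _ _ _ _ _ _ _ ok') => //.
- by rewrite SE; apply/setP => i; rewrite !inE; case: eqP => [->|].
- by rewrite rotate_itv// offset_itv.
- move=> i t tvs' iE; rewrite (tvs _ t.+1)// iE modnDml.
  by rewrite addSnnS.
Qed.

(** Injectivity makes [p] the only index of the depot, so the search cannot stop earlier. Each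
    advance takes two steps and the failing test one. *)
Lemma find_depot_exec m j k L x q s cont t P (p : 'I_N) :
  injective tau -> tau p = ord0 ->
  mem_ok m j k L x -> (j <= p)%N ->
  (forall m', mem_ok m' p k L x -> wp cont t P (State m' q s)) ->
  wp (Seq (find_depot R) cont) (2 * (p - j) + 1 + t)%N P (State m q s).
Proof.
clear demand_itv c_itv => tau_inj tp + + h; move e : (p - j)%N => r.
elim: r m j e => [|r IH] m j e ok jp.
  have jE : j = p by lia.
  apply: wp_while_false; last by apply: h; rewrite -jE.
  by rewrite /= (ok_index ok) jE (ok_tour ok) tp.
have jN : (j < N)%N by apply: leq_ltn_trans (ltn_ord p).
rewrite (_ : 2 * r.+1 + 1 + t = (2 * r + 1 + t).+2)%N; last lia.
apply: wp_while_true.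
  rewrite /= (ok_index ok) (ok_tour ok (Ordinal jN)) leqn0.
  apply/eqP => t0; have /tau_inj jE : tau (Ordinal jN) = tau p.
    by apply: ord_inj; rewrite t0 tp.
  by move: e; rewrite -jE /= subnn.
apply: (wp_set_index ok (j' := j.+1)); first by rewrite /= (ok_index ok) addn1.
by move=> m' ok'; apply: (IH m' j.+1) => //; lia.
Qed.

End Correctness.

Section Cap.
Variables (R : realType) (alpha : R) (n : nat) (I : instance R n).

(** The last clause gives the two cases of the ratio analysis. *)
Lemma cap_spec :
  [/\ 0 <= cap alpha I <= capacity I,
      alpha * coef_b I * cap alpha I <= 4 * coef_a I &
      cap alpha I = capacity I \/
      alpha * coef_b I * cap alpha I = 4 * coef_a I].
Proof.
have Q0 := capacity_gt0 I; have a0 := coef_a_ge0 I; have b0 := coef_b_ge0 I.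
rewrite /cap; case: (leP _ (4 * _)) => h.
  by split; [rewrite lexx andbT ltW| |left].
have ab0 : 0 < alpha * coef_b I.
  rewrite -(pmulr_lgt0 _ Q0); apply: le_lt_trans h.
  by rewrite mulr_ge0.
split; last by right; rewrite mulrC divfK// gt_eqF.
  apply/andP; split; last by rewrite ler_pdivrMr// [leRHS]mulrC ltW.
  by apply: divr_ge0; [rewrite mulr_ge0|rewrite ltW].
by rewrite mulrC divfK// gt_eqF.
Qed.

End Cap.

Lemma algorithm_exec (R : realType) (alpha : R) (tsp : prog R (assign R)) n
    (I : instance R n) (demand : 'I_n -> R) (tape : nat -> R) t m
    (tau : {perm 'I_n.+1}) (p : 'I_n.+1) (vs : seq 'I_n) :
  (forall i, 0 <= demand i <= capacity I) -> 0 <= tape 0%N <= 1 ->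
  offline_exec I tsp (mem0 R) t m -> (forall i : 'I_n.+1, nreg m i = tau i) ->
  tau p = ord0 -> uniq vs -> (forall i, i \in vs) ->
  (forall (j : 'I_n.+1) t, (t < n)%N ->
    nat_of_ord j = ((p + t.+1) %% n.+1)%N ->
    tau j = nth ord0 (map (lift ord0) vs) t) ->
  wp (fun s => beval I (memory s)) (instr_step I demand tape)
    (algorithm alpha tsp) (t + 32 * n.+1)%N
    (fun s => complete (truck s) /\
       spent (truck s) = trip_cost I (cap alpha I) demand ord0 vs (tape 0%N))
    (state0 R n).
Proof.
move=> d_itv u01 et mtau tp uvs avs tvs.
have [c_itv _ _] := cap_spec alpha I; have [c0 cQ] := andP c_itv.
have [u0 u1] := andP u01.
have szvs : size vs = n.
  by rewrite -(card_uniqP uvs) -[RHS]card_ord; apply: eq_card => i; rewrite avs.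
have cu_itv : 0 <= cap alpha I * tape 0%N <= capacity I.
  by rewrite mulr_ge0//=; apply: le_trans cQ; rewrite ler_piMr.
apply: wp_seq; first exact: online_exec_compute et.
(* Ten steps of setup, the search for the depot, and the service. *)
apply: (@wp_leq _ _ _ _ _ _ _ (10 + (2 * (p - 0) + 1 + (17 * size vs + 2)))%N).
  by rewrite szvs; have := ltn_ord p; lia.
do 3 (apply: wp_do; first exact: step_param).
apply: wp_if.
set body := if _ then _ else _; set m3 := set_rreg _ _ _.
(* Both branches write register 0, so they merge into one assignment of a conditional expression. *)
have -> : body = rset 0 (if alpha * coef_b I * capacity I <= 4 * coef_a I
    then Q_reg R
    else RDiv (RMul (RLit 4) (a_reg R)) (RMul (RLit alpha) (b_reg R))).
  by rewrite /body /=; case: ifP.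
apply: wp_do; first by apply: step_compute; exact: step_rset.
have capE : reval I m3 (if alpha * coef_b I * capacity I <= 4 * coef_a I
    then Q_reg R
    else RDiv (RMul (RLit 4) (a_reg R)) (RMul (RLit alpha) (b_reg R))) =
    cap alpha I by rewrite /cap; case: ifP.
rewrite capE {body capE}.
apply: wp_do; first exact: step_draw.
apply: wp_do; first by apply: step_compute; exact: step_rset.
apply: wp_do; first by apply: (@load_step _ _ _ _ _ _ _ _ _
  (cap alpha I * tape 0%N)).
set m4 := set_rreg _ _ _.
(* Only real registers were written since the TSP program halted: its tour is intact, while the
   index and the counter still hold leftovers. *)
have ok : mem_ok (cap alpha I) tau m4 (nreg m n.+1) (nreg m (n.+1 + 1))
    (cap alpha I * tape 0%N) (rreg m 2) by split.
apply: (wp_set_index ok (j' := 0%N)) => // m5 {}ok.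
apply: (wp_set_count ok (k' := size vs)) => [|m6 {}ok].
  by rewrite /= subn1 szvs.
apply: (find_depot_exec (@perm_inj _ tau) tp ok) => // m7 {}ok.
rewrite -(add0r (trip_cost _ _ _ _ _ _)).
apply: serve_exec ok _ uvs _ _ _ => //.
  by apply/setP => i; rewrite !inE avs.
by rewrite szvs.
Qed.

(** * Averaging over the initial load, independent of the demands *)

Section Independence.
Variables (R : realType) (n : nat) (I : instance R n).
Variables (d : measure_display) (T : measurableType d) (P : probability T R).
Variables (chi : 'I_n -> {RV P >-> (measurableTypeR R)}).
Variables (U : nat -> {RV P >-> (measurableTypeR R)}).
Hypothesis model : random_model I chi U.

(** Rectangles form a pi-system on which independence can be read off [mutually_independent]. *)
Definition demand_events : set (set T) :=
  [set S | exists2 A : 'I_n -> set (measurableTypeR R),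
    (forall i, measurable (A i)) & S = \bigcap_i (chi i @^-1` A i)].

(* [T] with the sigma-algebra generated by the demands, of which the tape is
   independent. *)
Definition demand_space := g_sigma_algebraType demand_events.

Lemma demand_events_measurable : demand_events `<=` measurable.
Proof.
move=> _ [A mA ->]; apply: fin_bigcap_measurable => // i _.
by rewrite -[X in measurable X]setTI; exact: measurable_funPT.
Qed.

Lemma demand_eventsI : setI_closed demand_events.
Proof.
move=> _ _ [A mA ->] [B mB ->]; exists (fun i => A i `&` B i).
  by move=> i; exact: measurableI.
by rewrite -bigcapI; apply: eq_bigcapr => i _; rewrite preimage_setI.
Qed.

(** As functions of [S], both sides are finite measures that agree on the pi-system of rectangles,
    hence on the sigma-algebra it generates. *)
Lemma tape_demand_independent j (A : set (measurableTypeR R)) (S : set T) :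
  measurable A -> <<s demand_events >> S ->
  P (U j @^-1` A `&` S) = (P (U j @^-1` A) * P S)%E.
Proof.
move=> mA; have mUA : measurable (U j @^-1` A).
  by rewrite -[X in measurable X]setTI; exact: measurable_funPT.
have r0 : 0 <= fine (P (U j @^-1` A)) by exact: fine_ge0.
pose m2 := mscale (NngNum r0) P.
move=> GS.
have PUA : (fine (P (U j @^-1` A)))%:E = P (U j @^-1` A).
  by rewrite fineK// fin_num_measure.
have m2E B : m2 B = (P (U j @^-1` A) * P B)%E by rewrite -PUA.
rewrite setIC -m2E.
apply: (@g_sigma_algebra_measure_unique _ R T demand_events
  demand_events_measurable (fun=> setT) _ _ (mrestr P mUA) m2) => //.
- move=> _; exists (fun=> setT) => //.
  by apply/seteqP; split => x.
- by rewrite bigcup_const//; exists 0%N.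
- exact: demand_eventsI.
- move=> _ [B mB ->]; apply: (etrans _ (esym (m2E _))); rewrite /= /mrestr.
  pose BA (k : 'I_n + nat) := if k is inl i then B i else A.
  have mBA k : measurable (BA k) by case: k.
  (* Used for two finite families: all demands, and all demands together with the draw [j]. *)
  have indep s us := demand_tape_independent model (s := s) us mBA.
  pose s0 : seq ('I_n + nat)%type := [seq inl i | i <- enum 'I_n].
  have us : uniq s0.
    by rewrite map_inj_uniq ?enum_uniq// => i i' [].
  have uj : uniq (inr j :: s0).
    by rewrite cons_uniq us andbT; apply/mapP => -[].
  have := indep _ uj; have := indep _ us; rewrite big_cons => <- /=.
  have s0E : [set` s0] = inl @` [set: 'I_n].
    apply/seteqP; split => k /=; first by case/mapP => i _ ->; exists i.
    by case=> i _ <-; rewrite map_f// mem_enum.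
  have sjE : [set` inr j :: s0] = inr j |` [set` s0].
    apply/seteqP; split => k /=.
      by rewrite inE => /predU1P[]; [left|right].
    by case=> [->|ks]; rewrite inE ?eqxx// ks orbT.
  rewrite sjE bigcap_setU1 s0E bigcap_image /= => <-.
  by rewrite setIC.
- by move=> _; rewrite /= /mrestr setTI; apply: le_lt_trans (ltry 1);
     exact: probability_le1.
Qed.

Lemma measurable_demand i :
  measurable_fun setT (chi i : demand_space -> measurableTypeR R).
Proof.
move=> _ A mA; rewrite setTI; apply: sub_sigma_algebra.
exists (fun k => if k == i then A else setT) => [k|]; first by case: ifP.
apply/seteqP; split => x /=; last by move=> /(_ i Logic.I) /=; rewrite eqxx.
by move=> Ax k _ /=; case: eqP => // ->.
Qed.

Lemma measurable_to_demand_space : measurable_fun setT (id : T -> demand_space).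
Proof.
move=> _ A mA; rewrite setTI preimage_id.
exact: (smallest_sub (@sigma_algebra_measurable _ T) demand_events_measurable).
Qed.

Variables (c : R) (vs : seq 'I_n).
Hypothesis c_ge0 : 0 <= c.

Definition mean_trip_cost (x : T) : \bar R :=
  (\int[lebesgue_measure]_(u in `[0%R, 1%R[)
    (trip_cost I c (fun i => chi i x) ord0 vs u)%:E)%E.

(** The absolute value gives Tonelli a nonnegative integrand on the whole product; it changes
    nothing at loads in [[0, 1]] and admissible demands. *)
Let f (z : measurableTypeR R * demand_space) : \bar R :=
  (`|trip_cost I c (fun i => chi i z.2) ord0 vs z.1|)%:E.

Let measurable_f : measurable_fun setT f.
Proof.
apply/measurable_EFinP; apply: measurableT_comp => //.
apply: (@measurable_trip_cost _ _ I c _ (measurableTypeR R * demand_space)%type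
  (fun i z => chi i z.2) ord0 vs fst) => // i.
by apply: (measurableT_comp (measurable_demand i)).
Qed.

Lemma mean_trip_costE x :
  (\int[distribution P (U 0)]_u f (u, x) = mean_trip_cost x)%E.
Proof.
rewrite (eq_measure_integral (uniform_prob (@ltr01 R))); last first.
  by move=> A mA _; exact: (tape_law model).
rewrite integral_uniform; last 2 first.
- exact: (measurable_fun_pair1 x measurable_f).
- by move=> u; rewrite lee_fin.
rewrite subr0 invr1 mul1e -integral_itv_bndo_bndc; last first.
  by apply: measurable_funTS; exact: (measurable_fun_pair1 x measurable_f).
apply: eq_integral_itv => u /andP[u0 u1]; rewrite ger0_norm//.
apply: trip_cost_ge0 => //= [i|]; last by rewrite u0 ltW.
by have /andP[] := demand_bounds model i x.
Qed.

(** The identity into [demand_space] serves as the demand vector: it determines all demands and is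
    independent of [U 0]. *)
Lemma expected_trip_cost :
  measurable_fun setT mean_trip_cost /\
  (\int[P]_x (trip_cost I c (fun i => chi i x) ord0 vs (U 0 x))%:E =
   \int[P]_x mean_trip_cost x)%E.
Proof.
pose mid := isMeasurableFun.Build _ _ _ _ _ measurable_to_demand_space.
pose Y : {mfun T >-> demand_space} := HB.pack (id : T -> demand_space) mid.
have f0 z : (0 <= f z)%E by rewrite lee_fin.
split.
  have := measurable_fun_fubini_tonelli_G (m1 := distribution P (U 0))
    f measurable_f f0.
  move=> /measurableT_comp /(_ measurable_to_demand_space).
  by apply: eq_measurable_fun => x _ /=; rewrite -mean_trip_costE.
transitivity (\int[P]_x f (U 0%N x, Y x))%E.
  apply: eq_integral => x _; rewrite /f /= ger0_norm//.
  apply: trip_cost_ge0 => //= [i|]; last exact: (tape_bounds model).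
  by have /andP[] := demand_bounds model i x.
rewrite (ge0_integral_independent _ measurable_f f0); last first.
  by move=> A B mA mB; exact: tape_demand_independent.
by apply: eq_integral => x _; exact: mean_trip_costE.
Qed.

End Independence.

(** * The approximation ratio *)

Definition discrete_weight (R : realType) (N : nat) (u v : 'I_N) : R :=
  (u != v)%:R.

Lemma discrete_weight_triangle (R : realType) (N : nat) (u v x : 'I_N) :
  discrete_weight R u x <= discrete_weight R u v + discrete_weight R v x.
Proof.
rewrite /discrete_weight; have [->|_] := eqVneq u v; first by rewrite add0r.
by apply: le_trans (_ : 1 <= _); rewrite ?lern1 ?leq_b1// lerDl.
Qed.

Definition discrete_metric (R : realType) (N : nat) : metric R N.
Proof.
apply: (@Metric _ _ (@discrete_weight R N)).
- by move=> u v; rewrite ler0n.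
- by move=> v; rewrite /discrete_weight eqxx.
- by move=> u v; rewrite /discrete_weight eq_sym.
- exact: discrete_weight_triangle.
Defined.

(** With two vertices at distance 1 every tour weighs 2; comparing the returned tour with itself
    gives the bound. *)
Lemma tsp_ratio_ge1 (R : realType) (alpha : R) c :
  tsp_approx_algorithm alpha c -> 1 <= alpha.
Proof.
move=> [C [k /(_ 1%N (discrete_metric R 2)) [t [m [s [_ _ _ /(_ s)]]]]]].
have -> : tour_weight (discrete_metric R 2) s = 2.
  rewrite /tour_weight /= /discrete_weight.
  rewrite (eq_bigr (fun=> 1)); first by rewrite sumr_const card_ord.
  move=> i _; rewrite (inj_eq perm_inj); suff -> : i != ordS i by [].
  by case: i => -[|[|//]] ?.
by move=> h; lra.
Qed.

Section Ratio.
Variables (R : realType) (alpha : R) (n : nat) (I : instance R n).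
Variables (demand : 'I_n -> R).
Hypothesis alpha_ge1 : 1 <= alpha.
Hypothesis demand_itv : forall i, 0 <= demand i <= capacity I.

(** [W] is replaced by [alpha * len]. At full capacity the detours are paid through
    [2 * eta <= c * len]; at the smaller cap they are paid by the demand term, and the bound follows
    from the equation defining the cap. *)
Lemma trip_cost_bound (W len : R) (vs : seq 'I_n) :
  uniq vs -> (forall i, i \in vs) -> W <= alpha * len ->
  2 * radial_demand I demand <= capacity I * len ->
  (coef_a I + coef_b I * cap alpha I / 2) * W +
  \sum_(v <- vs) (4 * coef_a I * detour_prob (cap alpha I) (demand v) +
                  2 * coef_b I * demand v) * I ord0 (lift ord0 v)
  <= (alpha + 2) * (coef_a I * len + coef_b I * radial_demand I demand).
Proof.
move=> uvs avs Wlen len_ge.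
have -> : \sum_(v <- vs) (4 * coef_a I * detour_prob (cap alpha I) (demand v) +
    2 * coef_b I * demand v) * I ord0 (lift ord0 v) =
  4 * \sum_v coef_a I * detour_prob (cap alpha I) (demand v) *
         I ord0 (lift ord0 v) +
  2 * (coef_b I * radial_demand I demand).
  rewrite (@big_uniq _ _ _ _ vs)//= (eq_bigl xpredT) => [|i]; last first.
    by rewrite avs.
  rewrite /radial_demand !mulr_sumr -big_split; apply: eq_bigr => v _ /=.
  by ring.
have Q0 := capacity_gt0 I; have a0 := coef_a_ge0 I; have b0 := coef_b_ge0 I.
have [/andP[c0 cQ] le_c cE] := cap_spec alpha I.
set c := cap alpha I in c0 cQ le_c cE *.
set eta := radial_demand I demand in len_ge *.
have abc0 : 0 <= coef_a I + coef_b I * c / 2.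
  by rewrite addr_ge0// divr_ge0// mulr_ge0.
apply: le_trans (_ : (coef_a I + coef_b I * c / 2) * (alpha * len) +
  (4 * \sum_v coef_a I * detour_prob c (demand v) * I ord0 (lift ord0 v) +
   2 * (coef_b I * eta)) <= _); first by rewrite lerD2r ler_wpM2l.
case: cE => cE.
  have -> : \sum_v coef_a I * detour_prob c (demand v) * I ord0 (lift ord0 v) =
      coef_a I * (eta / c).
    rewrite /eta /radial_demand mulr_suml mulr_sumr; apply: eq_bigr => v _.
    rewrite /detour_prob cE; have /andP[_ ->] := demand_itv v.
    by ring.
  pose y := 2 * eta / c.
  have c_gt0 : 0 < c by rewrite cE.
  have etaE : eta = c * y / 2 by rewrite /y; field; rewrite gt_eqF.
  have ylen : y <= len by rewrite /y ler_pdivrMr// [leRHS]mulrC cE.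
  (* The gap between the two sides is half of this product. *)
  have : 0 <= (len - y) * (4 * coef_a I - alpha * coef_b I * c).
    by rewrite mulr_ge0// subr_ge0.
  have -> : eta / c = y / 2 by rewrite etaE; field; rewrite gt_eqF.
  by rewrite etaE; lra.
(* Here [4 * coef_a I = alpha * coef_b I * c], and [c] times the detour probability is at most the
   demand. *)
have : 4 * (\sum_v coef_a I * detour_prob c (demand v) * I ord0 (lift ord0 v))
    <= alpha * (coef_b I * eta).
  rewrite /eta /radial_demand !mulr_sumr; apply: ler_sum => v _.
  have cp : c * detour_prob c (demand v) <= demand v.
    have /andP[d0 _] := demand_itv v.
    rewrite /detour_prob; case: (leP (demand v) c) => dc; last first.
      by rewrite mulr1 ltW.
    have [->|c_neq0] := eqVneq c 0; first by rewrite mul0r.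
    by rewrite mulrCA divff// mulr1.
  rewrite -!mulrA !mulrA -cE.
  rewrite [leLHS](_ : _ = alpha * coef_b I * I ord0 (lift ord0 v) *
    (c * detour_prob c (demand v))); last by ring.
  rewrite [leRHS](_ : _ = alpha * coef_b I * I ord0 (lift ord0 v) * demand v);
    last by ring.
  apply: ler_wpM2l => //; apply: mulr_ge0; last exact: weight_ge0.
  by apply: mulr_ge0 => //; apply: le_trans alpha_ge1.
(* The load part of the tour cost thus becomes [2 * coef_a I * len]. *)
have : alpha * coef_b I * c * len = 4 * coef_a I * len by rewrite cE.
by lra.
Qed.

End Ratio.

(** * From single outcomes to expectations *)

Section ExpectedRatio.
Variables (R : realType) (alpha : R) (n : nat) (I : instance R n).
Hypothesis alpha_ge1 : 1 <= alpha.
Variables (d : measure_display) (T : measurableType d) (P : probability T R).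
Variables (chi : 'I_n -> {RV P >-> (measurableTypeR R)}).
Variables (U : nat -> {RV P >-> (measurableTypeR R)}).
Hypothesis model : random_model I chi U.
Variables (tau : {perm 'I_n.+1}) (vs : seq 'I_n).
Hypothesis tau_approx : forall s : {perm 'I_n.+1},
  tour_weight I tau <= alpha * tour_weight I s.
Hypothesis vs_uniq : uniq vs.
Hypothesis mem_vs : forall i, i \in vs.
Hypothesis vs_tau : tour_weight I tau = route_weight I ord0 vs ord0.

(** The lower bound holds outcome by outcome; only the initial load has to be averaged. *)
Lemma mean_trip_cost_le pi x z :
  policy_cost I (fun i => chi i x) pi z ->
  (mean_trip_cost I chi (cap alpha I) vs x <= ((alpha + 2) * z)%:E)%E.
Proof.
have d_itv i : 0 <= chi i x <= capacity I by exact: (demand_bounds model).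
have d0 i : 0 <= chi i x by have /andP[] := d_itv i.
have [/andP[c0 _] _ _] := cap_spec alpha I.
move=> /(policy_cost_ge d0) [len [s [slen len_ge] z_ge]].
apply: (le_trans (integral_trip_cost _ c0 _ _ d0)); rewrite lee_fin.
apply: (le_trans (trip_cost_bound alpha_ge1 d_itv vs_uniq mem_vs _ len_ge)).
  rewrite -vs_tau; apply: (le_trans (tau_approx s)).
  by apply: ler_wpM2l => //; apply: le_trans alpha_ge1.
by apply: ler_wpM2l => //; apply: addr_ge0 => //; apply: le_trans alpha_ge1.
Qed.

Lemma expected_trip_cost_le :
  (\int[P]_x (trip_cost I (cap alpha I) (fun i => chi i x) ord0 vs (U 0 x))%:E
   <= (alpha + 2)%:E * optimal_expected_cost I chi U)%E.
Proof.
have [/andP[c0 _] _ _] := cap_spec alpha I.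
have [mm ->] := expected_trip_cost model vs c0.
have rho_gt0 : 0 < alpha + 2.
  by apply: ltr_wpDl => //; apply: le_trans alpha_ge1.
(* Dividing by the positive ratio isolates the infimum, leaving a comparison with each single
   policy. *)
rewrite -lee_pdivrMl//; apply/ereal_infP => _ [pi [Z [mZ Zcost ->]]].
rewrite lee_pdivrMl//.
have mean0 x : (0 <= mean_trip_cost I chi (cap alpha I) vs x)%E.
  apply: integral_ge0 => u /=; rewrite in_itv/= => /andP[u0 u1].
  rewrite lee_fin; apply: trip_cost_ge0 => //= [i|]; last by rewrite u0 ltW.
  by have /andP[] := demand_bounds model i x.
have le_ae x : policy_cost I (fun i => chi i x) (pi (fun j => U j x)) (Z x) ->
    (mean_trip_cost I chi (cap alpha I) vs x <= ((alpha + 2) * Z x)%:E)%E.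
  exact: mean_trip_cost_le.
have Z0 x : policy_cost I (fun i => chi i x) (pi (fun j => U j x)) (Z x) ->
    0 <= Z x.
  move=> /le_ae /(le_trans (mean0 x)); rewrite lee_fin pmulr_rge0//.
(* [Z] is nonnegative only almost everywhere. *)
have -> : (\int[P]_x (Z x)%:E = \int[P]_x `|Z x|%:E)%E.
  apply: ae_eq_integral => //.
  - exact/measurable_EFinP.
  - by apply/measurable_EFinP; exact: measurableT_comp.
  - by apply: filterS Zcost => x /Z0 Zx _; rewrite ger0_norm.
rewrite -ge0_integralZl//; last 2 first.
- by apply/measurable_EFinP; exact: measurableT_comp.
- by rewrite lee_fin ltW.
apply: ae_ge0_le_integral => //.
- by move=> x _; rewrite -EFinM lee_fin mulr_ge0// ltW.
- apply/measurable_EFinP; apply: measurable_funM => //.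
  exact: measurableT_comp.
apply: filterS Zcost => x Zx _; apply: (le_trans (le_ae _ Zx)).
by rewrite -EFinM lee_fin ger0_norm// Z0.
Qed.

End ExpectedRatio.

Theorem theorem2 (R : realType) (alpha : R) :
  (exists c, @tsp_approx_algorithm R alpha c) ->
  exists c, @cuvrpsd_approx_algorithm R (alpha + 2) c.
Proof.
move=> [tsp tspP]; have alpha_ge1 := tsp_ratio_ge1 tspP.
case: tspP => C [k tspP]; exists (algorithm alpha tsp); split.
  (* The exponent [k.+1] is positive, so the linear term is absorbed even when [k = 0]. *)
  exists (C + 32)%N, k.+1 => n I demand tape d_itv tape_itv.
  have [t [m [tau [et le_t mtau _]]]] := tspP n I.
  have [p [vs [tp uvs avs tvs _]]] := perm_route I tau.
  have [t' [s [es le_t' [cs _]]]] :=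
    algorithm_exec alpha d_itv (tape_itv 0%N) et mtau tp uvs avs tvs.
  exists t', s; split => //; apply: (leq_trans le_t').
  rewrite mulnDl; apply: leq_add.
    by apply: (leq_trans le_t); rewrite leq_mul2l leq_pexp2l ?orbT.
  by rewrite leq_mul2l expnS leq_pmulr ?expn_gt0.
move=> n I d T P chi U model.
have [t [m [tau [et _ mtau tau_approx]]]] := tspP n I.
have [p [vs [tp uvs avs tvs vs_tau]]] := perm_route I tau.
have [/andP[c0 _] _ _] := cap_spec alpha I.
exists (\int[P]_x
  (trip_cost I (cap alpha I) (fun i => chi i x) ord0 vs (U 0%N x))%:E)%E.
  exists (fun x =>
    trip_cost I (cap alpha I) (fun i => chi i x) ord0 vs (U 0%N x)).
  split => //.
    apply: (@measurable_trip_cost _ _ I (cap alpha I) _ T (fun i x => chi i x)).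
      by move=> i; exact: (@measurable_funPT _ _ _ _ (chi i)).
    exact: (@measurable_funPT _ _ _ _ (U 0%N)).
  apply: aeW => x.
  have u_itv : 0 <= (fun j => U j x) 0%N <= 1 by exact: (tape_bounds model).
  have [t' [s [es _ [cs sE]]]] := @algorithm_exec _ alpha _ _ _ _
    (fun j => U j x) _ _ _ _ _ (demand_bounds model ^~ x) u_itv et mtau tp uvs
    avs tvs.
  by exists t', s.
exact: (expected_trip_cost_le alpha_ge1 model tau_approx uvs avs vs_tau).
Qed.
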